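(* Let $E(\mathbf{Q})$, $\mathbf{Q}=(\rho,\mathbf{m},s,\mathbf{j})$, $\mathbf{m}=\rho\mathbf{u}$, $s=\rho\eta$, be the energy $$E(\mathbf{Q})=\frac{1}{2\rho}\|\mathbf{m}\|^2+\rho\,\varepsilon(\rho,s/\rho)+\frac12\alpha(\rho)\|\mathbf{j}\|^2 ,$$ assumed convex in $\mathbf{Q}$ with positive definite Hessian. Let $\mathbf{U}=(\mu,\mathbf{u},\theta,\boldsymbol{\ell})=\nabla_{\mathbf{Q}}E$ (so $\mu=E_\rho$, $\boldsymbol{\ell}=\alpha(\rho)\mathbf{j}$) be the conjugate variables and $E^\star(\mathbf{U})=\mathbf{U}\cdot\mathbf{Q}-E(\mathbf{Q})$ the Legendre transform of $E$. Consider smooth solutions, with $\mathbf{j}$ curl-free, of the system in $\mathbb{R}^d$ $$\partial_t\rho+\mathrm{div}(\rho\mathbf{u})=0,$$ $$\partial_t(\rho\mathbf{u})+\mathrm{div}\Big(\rho\,\mathbf{u}\otimes\mathbf{u}+\Big(p+\tfrac12(\rho\alpha'(\rho)-\alpha(\rho))\|\mathbf{j}\|^2\Big)\mathbf{I}+\alpha(\rho)\,\mathbf{j}\otimes\mathbf{j}\Big)=0,$$ $$\partial_t\mathbf{j}+\nabla(\mathbf{j}\cdot\mathbf{u}+\theta)+\Big(\frac{\partial\mathbf{j}}{\partial\mathbf{x}}-\Big(\frac{\partial\mathbf{j}}{\partial\mathbf{x}}\Big)^T\Big)\mathbf{u}=-\frac{1}{\tau}\mathbf{j},$$ $$\partial_t(\rho\eta)+\mathrm{div}\big(\rho\eta\,\mathbf{u}+\alpha(\rho)\mathbf{j}\big)=\frac{\alpha(\rho)}{\tau\,\theta}\|\mathbf{j}\|^2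 .$$ Then, in the variables $\mathbf{U}$, the system takes the symmetric hyperbolic form in the sense of Friedrichs $$\tilde{\mathbf{A}}\,\partial_t\mathbf{U}+\sum_{i=1}^d\tilde{\mathbf{B}}^i\,\frac{\partial\mathbf{U}}{\partial x_i}=\mathbf{S},$$ where $\tilde{\mathbf{A}}=\nabla^2_{\mathbf{U}}E^\star$ is symmetric positive definite, the matrices $\tilde{\mathbf{B}}^i=\tilde{\mathbf{B}}^i(\mathbf{U})$ are symmetric, and $\mathbf{S}=\mathbf{S}(\mathbf{U})$ is the vector of source terms. More precisely $\tilde{\mathbf{B}}^i=\nabla^2_{\mathbf{U}}(E^\star u_i)+\tilde{\mathbf{B}}^i_2$, where $\tilde{\mathbf{B}}_2^i$ are the symmetric matrices for which $\sum_i\tilde{\mathbf{B}}^i_2\,\partial\mathbf{U}/\partial x_i$ has $\mu$-component $0$, $\mathbf{u}$-component $\mathrm{div}(\boldsymbol{\ell})\,E^\star_{\boldsymbol{\ell}}-\big(\frac{\partial\boldsymbol{\ell}}{\partial\mathbf{x}}\big)^TE^\star_{\boldsymbol{\ell}}$, $\boldsymbol{\ell}$-component $\nabla\theta-\mathrm{div}(\mathbf{u})\,E^\star_{\boldsymbol{\ell}}+\big(\frac{\partial\mathbf{u}}{\partial\mathbf{x}}\big)^TE^\star_{\boldsymbol{\ell}}$, and $\theta$-component $\mathrm{div}(\boldsymbol{\ell})$.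
   Context: Unknowns: $\rho>0$ (density), $\mathbf{u}\in\mathbb{R}^d$ (velocity), $\eta$ (specific entropy), $\mathbf{j}\in\mathbb{R}^d$. $\varepsilon(\rho,\eta)$ is a smooth specific internal energy, $p=\rho^2\partial\varepsilon/\partial\rho$, $\theta=\partial\varepsilon/\partial\eta>0$; $\alpha:(0,\infty)\to(0,\infty)$ is smooth; $\tau>0$ is a relaxation time (possibly a function of the state). $\frac{\partial\mathbf{v}}{\partial\mathbf{x}}$ denotes the Jacobian matrix with entries $\partial v_i/\partial x_j$; ''$\mathbf{j}$ curl-free'' means that $\frac{\partial\mathbf{j}}{\partial\mathbf{x}}$ is symmetric. The divergence of a second order tensor $\mathbf{A}$ is the vector with $\mathrm{div}(\mathbf{A})\cdot\mathbf{a}=\mathrm{div}(\mathbf{A}\mathbf{a})$ for every constant $\mathbf{a}$. $E^\star_{\boldsymbol{\ell}}=\partial E^\star/\partial\boldsymbol{\ell}=\mathbf{j}$. The components of vectors in the symmetric form are ordered as in $\mathbf{U}=(\mu,\mathbf{u},\theta,\boldsymbol{\ell})$. *)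

(* Defs.v *)
From HB Require Import structures.
From mathcomp Require Import all_boot all_order all_algebra.
From mathcomp Require Import all_classical all_reals all_analysis.

Set Implicit Arguments.
Unset Strict Implicit.
Unset Printing Implicit Defensive.

Import Order.TTheory GRing.Theory Num.Theory.
Import numFieldNormedType.Exports.

Local Open Scope classical_set_scope.
Local Open Scope ring_scope.

(** * Vector calculus on column vectors *)

(* The norm [`|v|] of a matrix is the sup norm; the squared Euclidean norm is
   [dot v v]. *)
Definition dot (R : realType) n (v w : 'cV[R]_n) : R :=
  \sum_(i < n) v i 0 * w i 0.

Definition evec (R : realType) n (i : 'I_n) : 'cV[R]_n := delta_mx i 0.
Arguments evec {R n} i.

Definition grad (R : realType) n (f : 'cV[R]_n -> R) (x : 'cV[R]_n) : 'cV[R]_n :=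
  \col_i 'D_(evec i) f x.

Definition jac (R : realType) n m (v : 'cV[R]_n -> 'cV[R]_m) (x : 'cV[R]_n) :
    'M[R]_(m, n) :=
  \matrix_(i, j) 'D_(evec j) (fun y => v y i 0) x.

Definition div (R : realType) n (v : 'cV[R]_n -> 'cV[R]_n) (x : 'cV[R]_n) : R :=
  \sum_(i < n) 'D_(evec i) (fun y => v y i 0) x.

(* The vector such that div(A) . a = div(A a) for every constant a. *)
Definition divT (R : realType) n (A : 'cV[R]_n -> 'M[R]_n) (x : 'cV[R]_n) :
    'cV[R]_n :=
  \col_k div (fun y => A y *m evec k) x.

Definition hess (R : realType) n (f : 'cV[R]_n -> R) : 'cV[R]_n -> 'M[R]_n :=
  jac (grad f).

Definition symmetric_mx (R : realType) n (A : 'M[R]_n) : Prop := A^T = A.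

Definition posdef (R : realType) n (A : 'M[R]_n) : Prop :=
  forall v : 'cV[R]_n, v != 0 -> 0 < (v^T *m A *m v) 0 0.

(* Class C^k on an open subset D of a finite-dimensional space, by iterated
   directional derivatives. *)
Fixpoint Ck (R : realType) (V W : normedModType R) (k : nat) (D : set V)
    (f : V -> W) : Prop :=
  match k with
  | 0%N => forall x, D x -> {for x, continuous f}
  | k'.+1 => (forall x, D x -> differentiable f x) /\
             (forall v : V, Ck k' D ('D_v f))
  end.

Definition smooth (R : realType) (V W : normedModType R) (D : set V)
    (f : V -> W) : Prop :=
  forall k, Ck k D f.

(** * State vectors *)

(* Both Q = (rho, m, s, j) and U = (mu, u, theta, l) have a scalar, a vector,
   a scalar and a vector block, in this order. *)
Notation dimS d := (1 + (d + (1 + d)))%N.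
Notation state R d := 'cV[R]_(dimS d).

Definition mkstate (R : realType) d (a : R) (v : 'cV[R]_d) (b : R)
    (w : 'cV[R]_d) : state R d :=
  col_mx (const_mx a : 'cV_1) (col_mx v (col_mx (const_mx b : 'cV_1) w)).

Definition blk1 (R : realType) d (X : state R d) : R := (usubmx X) 0 0.
Definition blk2 (R : realType) d (X : state R d) : 'cV[R]_d :=
  usubmx (dsubmx X).
Definition blk3 (R : realType) d (X : state R d) : R :=
  (usubmx (dsubmx (dsubmx X))) 0 0.
Definition blk4 (R : realType) d (X : state R d) : 'cV[R]_d :=
  dsubmx (dsubmx (dsubmx X)).

(** * Thermodynamics *)

Definition pressure (R : realType) (eps : R -> R -> R) (rho eta : R) : R :=
  rho ^+ 2 * derive1 (fun r => eps r eta) rho.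

Definition temperature (R : realType) (eps : R -> R -> R) (rho eta : R) : R :=
  derive1 (eps rho) eta.

Definition energy (R : realType) d (eps : R -> R -> R) (alpha : R -> R)
    (Q : state R d) : R :=
  let rho := blk1 Q in let m := blk2 Q in
  let s := blk3 Q in let j := blk4 Q in
  (2 * rho)^-1 * dot m m + rho * eps rho (s / rho)
  + 2^-1 * alpha rho * dot j j.

(* The pairs (rho, eta) occurring in a set of states. *)
Definition thermo (R : realType) d (D : set (state R d)) : set (R * R) :=
  [set (blk1 Q, blk3 Q / blk1 Q) | Q in D].

(* The state in D whose conjugate variable grad E is U (it is unique when E is
   strictly convex on the convex set D); junk value 0 outside grad E @` D. *)
Definition state_of (R : realType) n (D : set 'cV[R]_n) (E : 'cV[R]_n -> R)
    (U : 'cV[R]_n) : 'cV[R]_n :=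
  xget 0 [set Q | D Q /\ grad E Q = U].

Definition legendre (R : realType) n (D : set 'cV[R]_n) (E : 'cV[R]_n -> R)
    (U : 'cV[R]_n) : R :=
  dot U (state_of D E U) - E (state_of D E U).

(** * The system *)

(* Fields are functions of the time t and of the point x. *)
Definition conserved (R : realType) d (rho : R -> 'cV[R]_d -> R)
    (u : R -> 'cV[R]_d -> 'cV[R]_d) (eta : R -> 'cV[R]_d -> R)
    (j : R -> 'cV[R]_d -> 'cV[R]_d) (t : R) (x : 'cV[R]_d) : state R d :=
  mkstate (rho t x) (rho t x *: u t x) (rho t x * eta t x) (j t x).

Definition heat_flow_system (R : realType) d (eps : R -> R -> R)
    (alpha : R -> R) (tau : state R d -> R) (rho : R -> 'cV[R]_d -> R)
    (u : R -> 'cV[R]_d -> 'cV[R]_d) (eta : R -> 'cV[R]_d -> R)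
    (j : R -> 'cV[R]_d -> 'cV[R]_d) (t : R) (x : 'cV[R]_d) : Prop :=
  let theta s y := temperature eps (rho s y) (eta s y) in
  let p s y := pressure eps (rho s y) (eta s y) in
  let tau_tx := tau (conserved rho u eta j t x) in
  [/\ derive1 (fun s => rho s x) t + div (fun y => rho t y *: u t y) x = 0,
      derive1 (fun s => rho s x *: u s x) t
      + divT (fun y =>
          rho t y *: (u t y *m (u t y)^T)
          + (p t y + 2^-1 * (rho t y * derive1 alpha (rho t y) - alpha (rho t y))
                     * dot (j t y) (j t y))%:M
          + alpha (rho t y) *: (j t y *m (j t y)^T)) x = 0,
      derive1 (fun s => j s x) t
      + grad (fun y => dot (j t y) (u t y) + theta t y) x
      + (jac (j t) x - (jac (j t) x)^T) *m u t x
      = - (tau_tx^-1 *: j t x)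
    & derive1 (fun s => rho s x * eta s x) t
      + div (fun y => (rho t y * eta t y) *: u t y
                      + alpha (rho t y) *: j t y) x
      = alpha (rho t x) / (tau_tx * theta t x) * dot (j t x) (j t x)].

(** * The symmetric form *)

Definition source (R : realType) d (eps : R -> R -> R) (alpha : R -> R)
    (tau : state R d -> R) (Q : state R d) : state R d :=
  let rho := blk1 Q in let j := blk4 Q in
  let theta := temperature eps rho (blk3 Q / rho) in
  mkstate 0 0 (alpha rho / (tau Q * theta) * dot j j) (- ((tau Q)^-1 *: j)).

(* The value at x of sum_i B2^i dU/dx_i, for a field U = (mu, u, theta, l). *)
Definition B2_terms (R : realType) d (Es : state R d -> R)
    (U : 'cV[R]_d -> state R d) (x : 'cV[R]_d) : state R d :=
  let u y := blk2 (U y) in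
  let theta y := blk3 (U y) in
  let l y := blk4 (U y) in
  let Es_l := blk4 (grad Es (U x)) in
  mkstate 0
    (div l x *: Es_l - (jac l x)^T *m Es_l)
    (div l x)
    (grad theta x - div u x *: Es_l + (jac u x)^T *m Es_l).

Definition is_B2 (R : realType) d (DU : set (state R d)) (Es : state R d -> R)
    (B2 : 'I_d -> state R d -> 'M[R]_(dimS d)) : Prop :=
  (forall i U, DU U -> symmetric_mx (B2 i U)) /\
  (forall (U : 'cV[R]_d -> state R d) (x : 'cV[R]_d),
     differentiable U x -> DU (U x) ->
     \sum_(i < d) B2 i (U x) *m 'D_(evec i) U x = B2_terms Es U x).

Definition friedrichs (R : realType) n d (DU : set 'cV[R]_n)
    (A : 'cV[R]_n -> 'M[R]_n) (B : 'I_d -> 'cV[R]_n -> 'M[R]_n) : Prop :=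
  forall U, DU U ->
  [/\ symmetric_mx (A U), posdef (A U) & forall i, symmetric_mx (B i U)].

Definition quasilinear_system (R : realType) n d (A : 'cV[R]_n -> 'M[R]_n)
    (B : 'I_d -> 'cV[R]_n -> 'M[R]_n) (S : 'cV[R]_n -> 'cV[R]_n)
    (U : R -> 'cV[R]_d -> 'cV[R]_n) (t : R) (x : 'cV[R]_d) : Prop :=
  A (U t x) *m derive1 (fun s => U s x) t
  + \sum_(i < d) B i (U t x) *m 'D_(evec i) (U t) x = S (U t x).

(* Main.v *)
Require Import Defs.
From HB Require Import structures.
From mathcomp Require Import all_boot all_order all_algebra.
From mathcomp Require Import all_classical all_reals all_analysis.
From mathcomp Require Import ring lra.

Set Implicit Arguments.
Unset Strict Implicit.
Unset Printing Implicit Defensive.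

Import Order.TTheory GRing.Theory Num.Theory.
Import numFieldNormedType.Exports.

Local Open Scope classical_set_scope.
Local Open Scope ring_scope.

(** Why the theorem holds.

    The gradient of E is strictly monotone on the convex set D because its Hessian
    is positive definite (grad_strictly_monotone); hence the conjugate variables
    U = grad E(Q) determine Q. The equation grad E(Q) = U is solved, for U near
    grad E(Q0), by minimizing E - U.Q over a small closed ball around Q0
    (grad_locally_onto), which shows at once that the set of conjugate variables
    is open and that Q(U) is continuous; the invertible Hessian then makes Q(U)
    differentiable (inverse_differentiable). In the derivative of
    Es(U) = U.Q(U) - E(Q(U)) the terms with the derivative of Q(U) cancel, so that
    grad Es(U) = Q(U), and the Hessian of Es is the inverse of that of E, positive
    definite and continuous (Ck2_legendre). The symmetry of all Hessians involved
    is the equality of mixed second derivatives (derive_comm).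

    For the system, the chain rule gives A d_t U = d_t Q, and
    hess(Es u_i) d_i U = d_i (u_i Q + Es d u_i / d U) since
    grad(Es u_i) = u_i grad Es + Es grad u_i (quasilinear_conservative). Thus the
    Hessian part of the quasilinear system is the Galilean part of the flux: mass,
    momentum, entropy and j are transported by u and Es acts as a pressure. The
    explicit expression of the energy yields
    Es = p + (rho alpha' + alpha) |j|^2 / 2 (legendre_energy), so the pressure of
    the heat flow system is Es - l.j with l = alpha j. What remains of the
    momentum flux, div(l j^T) - grad(l.j), and of the equation for j is not in
    conservative form with respect to U; for a curl-free j it is equal to the
    terms in B2 (momentum_flux, curl_free_flux), because d_i j_k = d_k j_i
    exchanges advection terms with gradient terms.

    These terms are linear in the derivatives of U, with coefficient of the i-th
    one the map B2_op. It is self-adjoint: it couples u_k to l_m by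
    delta_im j_k - delta_ik j_m, which is also the coupling of l_m to u_k, and
    theta to l_i by 1. The matrices are determined by the identity they satisfy,
    since the affine fields U + x_i v have prescribed derivatives
    (is_B2_unique). *)

(** * Directional derivatives *)

Section ScalarRules.
Context {R : realType} {V : normedModType R}.
Implicit Types (f g : V -> R) (x v : V).

Lemma is_derive_add f g x v df dg : is_derive x v f df -> is_derive x v g dg ->
  is_derive x v (fun y => f y + g y) (df + dg).
Proof. by move=> hf hg; exact: is_deriveD. Qed.

Lemma is_derive_sub f g x v df dg : is_derive x v f df -> is_derive x v g dg ->
  is_derive x v (fun y => f y - g y) (df - dg).
Proof. by move=> hf hg; exact: is_deriveB. Qed.

Lemma is_derive_mul f g x v df dg : is_derive x v f df -> is_derive x v g dg ->
  is_derive x v (fun y => f y * g y) (df * g x + f x * dg).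
Proof.
move=> hf hg; apply: (is_derive_eq (is_deriveM hf hg)).
by rewrite addrC; congr (_ + _); rewrite mulrC.
Qed.

Lemma is_derive_inv f x v df : f x != 0 -> is_derive x v f df ->
  is_derive x v (fun y => (f y)^-1) (- df / f x ^+ 2).
Proof.
move=> fx0 [df1 <-]; apply: DeriveDef; first exact: derivableV.
by rewrite deriveV // mulNr mulrC -mulNr.
Qed.

Lemma is_derive_sum_fun n (h : 'I_n -> V -> R) x v (dh : 'I_n -> R) :
  (forall i, is_derive x v (h i) (dh i)) ->
  is_derive x v (fun y => \sum_i h i y) (\sum_i dh i).
Proof. by move=> H; have := is_derive_sum H; rewrite fct_sumE. Qed.

Lemma is_derive_diff (W : normedModType R) (f : V -> W) x v :
  differentiable f x -> is_derive x v f ('D_v f x).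
Proof. by move=> df; apply/derivableP/diff_derivable. Qed.

Lemma is_derive_val (W : normedModType R) (f : V -> W) x v df :
  is_derive x v f df -> 'D_v f x = df.
Proof. by case. Qed.

Lemma differentiable_id x : differentiable (fun y : V => y) x.
Proof. exact: ex_diff. Qed.

Lemma differentiable_mul f g x : differentiable f x -> differentiable g x ->
  differentiable (fun y => f y * g y) x.
Proof. exact: differentiableM. Qed.

Lemma differentiable_sum_fun n (W : normedModType R) (h : 'I_n -> V -> W) x :
  (forall i, differentiable (h i) x) ->
  differentiable (fun y => \sum_i h i y) x.
Proof. by move=> H; have := differentiable_sum H; rewrite fct_sumE. Qed.

End ScalarRules.

(** * Differentiation of matrix-valued maps *)

Section MatrixValued.
Context {R : realType}.

Lemma differentiable_mx (V : normedModType R) m n (F : V -> 'M[R]_(m, n)) x :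
  (forall i j, differentiable (fun y => F y i j) x) -> differentiable F x.
Proof.
move=> dF; rewrite (_ : F = fun y => \sum_i \sum_j F y i j *: delta_mx i j).
  apply: differentiable_sum_fun => i; apply: differentiable_sum_fun => j.
  exact: differentiableZl.
by apply/funext => y; rewrite [LHS]matrix_sum_delta.
Qed.

Lemma differentiable_mx_coord (V : normedModType R) m n
    (F : V -> 'M[R]_(m, n)) x i j :
  differentiable F x -> differentiable (fun y => F y i j) x.
Proof.
move=> dF; have := differentiable_comp dF (differentiable_coord (F x) i j).
exact.
Qed.

Lemma derive_mx_coord (V : normedModType R) m n (F : V -> 'M[R]_(m, n)) x v i j :
  differentiable F x -> ('D_v F x) i j = 'D_v (fun y => F y i j) x.
Proof. by move=> dF; rewrite derive_mx ?mxE //; exact: diff_derivable. Qed.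

Lemma is_derive_entry (V : normedModType R) n (F : V -> 'cV[R]_n) z v k :
  differentiable F z -> is_derive z v (fun y => F y k 0) (('D_v F z) k 0).
Proof.
by move=> dF; rewrite derive_mx_coord //;
  exact/is_derive_diff/differentiable_mx_coord.
Qed.

Lemma is_derive_coord m n (x v : 'M[R]_(m, n)) i j :
  is_derive x v (fun y : 'M[R]_(m, n) => y i j) (v i j).
Proof.
apply: DeriveDef; first exact/diff_derivable/differentiable_coord.
by rewrite -(derive_mx_coord (F := id)) ?derive_id.
Qed.

Lemma derive_chain (V W Z : normedModType R) (F : V -> W) (G : W -> Z) x v :
  differentiable F x -> differentiable G (F x) ->
  'D_v (fun y => G (F y)) x = 'D_('D_v F x) G (F x).
Proof.
move=> dF dG; rewrite deriveE; last exact: differentiable_comp.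
by rewrite diff_comp //= deriveE // deriveE.
Qed.

Lemma differentiable_near (V W : normedModType R) (f g : V -> W) x :
  (\near x, f x = g x) -> differentiable f x -> differentiable g x.
Proof.
move=> fg df; have fgx := nbhs_singleton fg.
have dfc : continuous ('d f x : V -> W) by exact: diff_continuous.
have E : g \o shift x = cst (g x) + 'd f x +o_ 0 id.
  apply/eqaddoP => _/posnumP[e].
  have := diff_locally df => /eqaddoP /(_ _ [elaborate gt0 e]).
  have fg0 : \forall h \near 0, f (h + x) = g (h + x).
    by move: fg; rewrite (near_shift 0 x) subr0; apply: filterS => h /=.
  rewrite -fgx; move: fg0; apply: filterS2 => h /= Hh.
  by rewrite /cst /= -[X in `|X|]/(f (h + x) - (f x + 'd f x h)) Hh.
by apply/diff_locallyP; rewrite (diff_unique dfc E); split.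
Qed.

Lemma is_diff_of (V W : normedModType R) (f : V -> W) (df : {linear V -> W}) x :
  continuous df -> f \o shift x = cst (f x) + df +o_ 0 id ->
  differentiable f x /\ forall v, 'D_v f x = df v.
Proof.
move=> cdf E; have dE := diff_unique cdf E.
have dif : differentiable f x by apply/diff_locallyP; rewrite dE.
by split=> // v; rewrite deriveE // dE.
Qed.

End MatrixValued.

(** * Maps of class C^k *)

Section Ck.
Context {R : realType} {V : normedModType R}.

(** On an open set the derivatives depend only on the values in that set. The
    closure properties below need this, since the formula for the derivative of
    a product, an inverse or a composite is only known on D. *)
Lemma Ck_ext (W : normedModType R) k (D : set V) (f g : V -> W) : open D ->
  (forall x, D x -> f x = g x) -> Ck k D f -> Ck k D g.
Proof.
move=> oD; elim: k f g => [|k IH] f g fg /=.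
  move=> cf x Dx; have nx : \near x, f x = g x.
    by apply: filterS (open_nbhs_nbhs (conj oD Dx)) => y; exact: fg.
  rewrite /prop_for /continuous_at -fg //.
  by apply: cvg_trans (cf x Dx); exact: near_eq_cvg.
have nx x : D x -> \near x, f x = g x.
  by move=> Dx; apply: filterS (open_nbhs_nbhs (conj oD Dx)) => y; exact: fg.
move=> [df dk]; split=> [x Dx|v].
  exact: differentiable_near (nx x Dx) (df x Dx).
by apply: IH (dk v) => x Dx; exact: near_eq_derive (nx x Dx).
Qed.

Lemma CkW (W : normedModType R) k (D : set V) (f : V -> W) :
  Ck k.+1 D f -> Ck k D f.
Proof.
elim: k f => [|k IH] f [df dk].
  by move=> x Dx; exact/differentiable_continuous/df.
by split=> // v; exact: IH.
Qed.

Lemma Ck_differentiable (W : normedModType R) k (D : set V) (f : V -> W) x :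
  Ck k.+1 D f -> D x -> differentiable f x.
Proof. by case=> + _; apply. Qed.

Lemma Ck_cst (W : normedModType R) k (D : set V) (c : W) : Ck k D (fun=> c).
Proof.
elim: k c => [|k IH] c /=; first by move=> x _; exact: cst_continuous.
split=> [x _|v]; first exact: differentiable_cst.
rewrite (_ : 'D_v (fun=> c) = fun=> 0); first exact: IH.
by apply/funext => x; exact: derive_cst.
Qed.

Lemma Ck_add k (D : set V) (f g : V -> R) : open D ->
  Ck k D f -> Ck k D g -> Ck k D (fun x => f x + g x).
Proof.
move=> oD; elim: k f g => [|k IH] f g.
  by move=> cf cg x Dx; apply: continuousD; [exact: cf|exact: cg].
move=> [df fk] [dg gk]; split=> [x Dx|v].
  by apply: differentiableD; [exact: df|exact: dg].
apply: Ck_ext (IH _ _ (fk v) (gk v)) => // x Dx.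
by apply/esym/is_derive_val/is_derive_add; apply/is_derive_diff;
  [exact: df|exact: dg].
Qed.

Lemma Ck_mul k (D : set V) (f g : V -> R) : open D ->
  Ck k D f -> Ck k D g -> Ck k D (fun x => f x * g x).
Proof.
move=> oD; elim: k f g => [|k IH] f g.
  by move=> cf cg x Dx; apply: continuousM; [exact: cf|exact: cg].
move=> Cf Cg; have [df fk] := Cf; have [dg gk] := Cg; split=> [x Dx|v].
  by apply: differentiableM; [exact: df|exact: dg].
have Cd := Ck_add oD (IH _ _ (fk v) (CkW Cg)) (IH _ _ (CkW Cf) (gk v)).
apply: Ck_ext oD _ Cd => x Dx.
by apply/esym/is_derive_val/is_derive_mul; apply/is_derive_diff;
  [exact: df|exact: dg].
Qed.

Lemma Ck_sum (I : Type) (r : seq I) k (D : set V) (f : I -> V -> R) :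
  open D -> (forall i, Ck k D (f i)) -> Ck k D (fun x => \sum_(i <- r) f i x).
Proof.
move=> oD Cf; elim: r => [|i r IH].
  by apply: Ck_ext (Ck_cst k D (0 : R)) => // x _; rewrite big_nil.
by apply: Ck_ext (Ck_add oD (Cf i) IH) => // x _; rewrite big_cons.
Qed.

Lemma Ck_prod (I : Type) (r : seq I) k (D : set V) (f : I -> V -> R) :
  open D -> (forall i, Ck k D (f i)) -> Ck k D (fun x => \prod_(i <- r) f i x).
Proof.
move=> oD Cf; elim: r => [|i r IH].
  by apply: Ck_ext (Ck_cst k D (1 : R)) => // x _; rewrite big_nil.
by apply: Ck_ext (Ck_mul oD (Cf i) IH) => // x _; rewrite big_cons.
Qed.

(** By induction on k, because the derivative - f' / f^2 is a product of f' with
    two copies of the inverse itself, in a lower class. *)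
Lemma Ck_inv k (D : set V) (f : V -> R) : open D ->
  (forall x, D x -> f x != 0) -> Ck k D f -> Ck k D (fun x => (f x)^-1).
Proof.
move=> oD f0; elim: k f f0 => [|k IH] f f0.
  by move=> cf x Dx; apply: continuousV; [exact: f0|exact: cf].
move=> Cf; have [df fk] := Cf; split=> [x Dx|v].
  by apply: differentiableV; [exact: df|exact: f0].
have Ci := IH _ f0 (CkW Cf).
apply: Ck_ext (Ck_mul oD (Ck_mul oD (Ck_cst k D (-1 : R)) (fk v))
  (Ck_mul oD Ci Ci)) => // x Dx.
rewrite (is_derive_val (is_derive_inv (f0 x Dx) (is_derive_diff v (df x Dx)))).
by rewrite expr2 invfM mulN1r.
Qed.

End Ck.

Lemma Ck_coord (R : realType) m n k (D : set 'M[R]_(m, n)) i j :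
  Ck k D (fun x : 'M[R]_(m, n) => x i j).
Proof.
case: k => [x _|k]; first exact: coord_continuous.
split=> [x _|v]; first exact: differentiable_coord.
rewrite (_ : 'D_v _ = fun=> v i j); first exact: Ck_cst.
by apply/funext => x; exact/is_derive_val/is_derive_coord.
Qed.


Lemma Ck_det (R : realType) (V : normedModType R) k (T : set V) m (A : V -> 'M[R]_m) :
  open T ->
  (forall i j, Ck k T (fun x => A x i j)) -> Ck k T (fun x => \det (A x)).
Proof.
move=> oT CA; rewrite /determinant; apply: Ck_sum => // s.
by apply: Ck_mul => //; [exact: Ck_cst|apply: Ck_prod].
Qed.

(** Cramer's rule: the entries of the inverse are rational in the entries. *)
Lemma Ck_invmx (R : realType) (V : normedModType R) k (T : set V) m
    (A : V -> 'M[R]_m) i j :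
  open T -> (forall x, T x -> A x \in unitmx) ->
  (forall i j, Ck k T (fun x => A x i j)) -> Ck k T (fun x => invmx (A x) i j).
Proof.
move=> oT uA CA.
have C1 : Ck k T (fun x => (\det (A x))^-1).
  apply: Ck_inv => //; last exact: Ck_det.
  by move=> x Tx; have := uA _ Tx; rewrite unitmxE unitfE.
have C2 : Ck k T (fun x => cofactor (A x) j i).
  rewrite /cofactor; apply: Ck_mul => //; first exact: Ck_cst.
  apply: Ck_det => // a b; apply: Ck_ext (CA (lift j a) (lift i b)) => // x _.
  by rewrite !mxE.
apply: Ck_ext (Ck_mul oT C1 C2) => // x Tx.
by rewrite /invmx uA // !mxE.
Qed.

Section CkComposition.
Context {R : realType} {V : normedModType R}.

Lemma pair_decomp (a b : R) : (a, b) = a *: (1, 0) + b *: (0, 1) :> R * R.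
Proof. by congr pair => /=; rewrite /GRing.scale /= !(mulr1, mulr0, addr0, add0r). Qed.

Lemma derive_comp2 (f : R * R -> R) (g1 g2 : V -> R) x v :
  differentiable f (g1 x, g2 x) -> differentiable g1 x -> differentiable g2 x ->
  'D_v (fun y => f (g1 y, g2 y)) x =
  'D_v g1 x * 'D_(1, 0) f (g1 x, g2 x) + 'D_v g2 x * 'D_(0, 1) f (g1 x, g2 x).
Proof.
move=> df d1 d2; have dg : differentiable (fun y => (g1 y, g2 y)) x.
  exact: differentiable_pair.
rewrite (derive_chain v dg df) !deriveE // diff_pair // (pair_decomp ('d g1 x v)).
by rewrite linearD !linearZ.
Qed.

(** The derivative of the composite is a sum of products of derivatives of g1 and
    g2 with composites of the partial derivatives of f, to which the induction
    hypothesis applies. *)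
Lemma Ck_comp2 k (D : set V) (T : set (R * R)) (f : R * R -> R)
    (g1 g2 : V -> R) : open D ->
  (forall x, D x -> T (g1 x, g2 x)) -> Ck k T f -> Ck k D g1 -> Ck k D g2 ->
  Ck k D (fun x => f (g1 x, g2 x)).
Proof.
move=> oD gT; elim: k f => [|k IH] f.
  move=> cf c1 c2 x Dx; have cfx := cf _ (gT _ Dx).
  rewrite /prop_for /continuous_at.
  have cf1 := c1 x Dx; have cf2 := c2 x Dx.
  apply: (@continuous2_cvg _ _ _ _ _ _ g1 g2 (fun a b => f (a, b)) _ _ _ cf1 cf2).
  by rewrite (_ : (fun z => _) = f) //; apply/funext => -[].
move=> [df fk] C1 C2; have [d1 k1] := C1; have [d2 k2] := C2; split=> [x Dx|v].
  apply: (@differentiable_comp _ _ _ _ (fun x => (g1 x, g2 x)) f).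
    by apply: differentiable_pair; [exact: d1|exact: d2].
  exact: (df _ (gT _ Dx)).
have Cc w := IH _ (fk w) (CkW C1) (CkW C2).
apply: Ck_ext (Ck_add oD (Ck_mul oD (k1 v) (Cc (1, 0)))
  (Ck_mul oD (k2 v) (Cc (0, 1)))) => // x Dx.
by rewrite derive_comp2 //; [exact: (df _ (gT _ Dx))|exact: d1|exact: d2].
Qed.

Lemma derive_comp1 (f : R -> R) (g : V -> R) x v :
  differentiable f (g x) -> differentiable g x ->
  'D_v (fun y => f (g y)) x = 'D_v g x * 'D_1 f (g x).
Proof.
move=> df dg; rewrite (derive_chain v dg df) !deriveE //.
by rewrite -[X in 'd f _ X]mulr1 [LHS]linearZ.
Qed.

Lemma Ck_comp1 k (D : set V) (T : set R) (f : R -> R) (g : V -> R) : open D ->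
  (forall x, D x -> T (g x)) -> Ck k T f -> Ck k D g ->
  Ck k D (fun x => f (g x)).
Proof.
move=> oD gT; elim: k f => [|k IH] f.
  by move=> cf c1 x Dx; apply: continuous_comp; [exact: c1|exact: (cf _ (gT _ Dx))].
move=> [df fk] C1; have [d1 k1] := C1; split=> [x Dx|v].
  by apply: (@differentiable_comp _ _ _ _ g f); [exact: d1|exact: (df _ (gT _ Dx))].
apply: Ck_ext (Ck_mul oD (k1 v) (IH _ (fk 1) (CkW C1))) => // x Dx.
by rewrite derive_comp1 //; [exact: (df _ (gT _ Dx))|exact: d1].
Qed.

End CkComposition.

(** * Mean value theorem on segments, symmetry of second derivatives *)

Section Segments.
Context {R : realType} {V : normedModType R}.

Lemma is_derive_line (f : V -> R) (x v : V) (s : R) :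
  differentiable f (x + s *: v) ->
  is_derive s 1 (fun r : R => f (x + r *: v)) ('D_v f (x + s *: v)).
Proof.
move=> df; have dl : differentiable (fun r : R => x + r *: v) s.
  by apply: differentiableD => //; exact: differentiableZl.
apply: DeriveDef.
  by apply/diff_derivable; exact: (differentiable_comp dl df).
rewrite (@derive_chain _ R _ _ _ _ _ 1 dl df); congr ('D_ _ f _).
rewrite deriveD ?derive_cst ?add0r; first last.
- by apply/diff_derivable; exact: differentiableZl.
- exact: derivable_cst.
rewrite deriveE; last exact: differentiableZl.
by rewrite (@diffZl _ R _ id) //= diff_val /= scale1r.
Qed.

Lemma segment_MVT (f : V -> R) (x v : V) (h : R) : 0 < h ->
  (forall s, 0 <= s <= h -> differentiable f (x + s *: v)) ->
  exists2 s, 0 < s < h & f (x + h *: v) - f x = h * 'D_v f (x + s *: v).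
Proof.
move=> h0 df; pose g (r : R) := f (x + r *: v).
have dg s : 0 <= s <= h -> is_derive s 1 g ('D_v f (x + s *: v)).
  by move=> /df; exact: is_derive_line.
have [s|s|s sh E] := @MVT R g (fun s => 'D_v f (x + s *: v)) 0 h h0.
- by rewrite in_itv /= => /andP[s0 sh]; apply: dg; rewrite !ltW.
- apply: derivable_within_continuous => r; rewrite in_itv /= => /dg [+ _].
  exact.
- exists s; first by move: sh; rewrite in_itv.
  by move: E; rewrite /g scale0r addr0 subr0 mulrC.
Qed.

(** The mean value theorem is applied to z |-> f (z + h w) - f z in the direction
    v, then to the derivative of f along v in the direction w. *)
Lemma second_difference (D : set V) (f : V -> R) (x v w : V) (h : R) :
  Ck 2 D f -> 0 < h ->
  (forall s t : R, 0 <= s <= h -> 0 <= t <= h -> D (x + s *: v + t *: w)) ->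
  exists s t, [/\ 0 <= s <= h, 0 <= t <= h &
    f (x + h *: v + h *: w) - f (x + h *: v) - (f (x + h *: w) - f x) =
    h * (h * 'D_w ('D_v f) (x + s *: v + t *: w))].
Proof.
move=> [df ddf] h0 Dst; have hh : 0 <= h <= h by rewrite ltW /=.
pose F z := f (z + h *: w) - f z.
have shiftE (s : R) : 0 <= s <= h ->
    differentiable f (x + s *: v + h *: w) /\ differentiable f (x + s *: v).
  move=> sh; split; first by apply: df; exact: Dst.
  apply: df; rewrite -(addr0 (x + _)) -(scale0r w); apply: Dst => //.
  by rewrite lexx ltW.
have dshift z : differentiable (fun z => z + h *: w) z.
  by apply: differentiableD.
have dsh z : differentiable f (z + h *: w) ->
    differentiable (fun z => f (z + h *: w)) z.
  by move=> dz; exact: (differentiable_comp (dshift z) dz).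
have Dsh z : differentiable f (z + h *: w) ->
    'D_v (fun z => f (z + h *: w)) z = 'D_v f (z + h *: w).
  move=> dz; rewrite (derive_chain v (dshift z) dz); congr ('D_ _ f _).
  by rewrite deriveD ?derive_cst ?derive_id ?addr0 //; exact: derivable_cst.
have [s sh Es] : exists2 s, 0 < s < h &
    F (x + h *: v) - F x = h * 'D_v F (x + s *: v).
  apply: (segment_MVT (f := F) h0) => s /shiftE[d1 d2].
  by apply: differentiableB => //; exact: dsh.
have sh' : 0 <= s <= h by case/andP: sh => ? ?; rewrite !ltW.
have [d1 d2] := shiftE s sh'.
have DF : 'D_v F (x + s *: v) = 'D_v f (x + s *: v + h *: w) - 'D_v f (x + s *: v).
  by rewrite deriveB ?Dsh //; apply/diff_derivable => //; exact: dsh.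
have [t th Et] : exists2 t, 0 < t < h &
    'D_v f (x + s *: v + h *: w) - 'D_v f (x + s *: v) =
    h * 'D_w ('D_v f) (x + s *: v + t *: w).
  by apply: (segment_MVT (f := 'D_v f) h0) => t th; apply: (ddf v).1; exact: Dst.
exists s, t; split=> //; first by case/andP: th => ? ?; rewrite !ltW.
by rewrite -Et -DF -Es /F; ring.
Qed.

(** The second difference of f is symmetric in v and w, so it equals h^2 times
    either mixed derivative at some point close to x; by continuity the two mixed
    derivatives agree at x. *)
Lemma derive_comm (D : set V) (f : V -> R) (x v w : V) : open D ->
  Ck 2 D f -> D x -> 'D_v ('D_w f) x = 'D_w ('D_v f) x.
Proof.
move=> oD Cf Dx; have [_ ddf] := Cf.
have cont (a b : V) : {for x, continuous ('D_a ('D_b f))}.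
  by have [_ /(_ a)] := ddf b; exact.
apply/eqP; rewrite -subr_eq0 -normr_le0; apply/ler_addgt0Pr => e e0.
rewrite add0r; have e2 : 0 < e / 2 by rewrite divr_gt0.
have nD : nbhs x D by exact: open_nbhs_nbhs.
have near_e (a b : V) :
    \forall y \near x, `|'D_a ('D_b f) x - 'D_a ('D_b f) y| <= e / 2.
  by have /cvgrPdist_le := cont a b; apply.
have [r /= r0 Hr] : nbhs_ball x [set y | [/\ D y,
    `|'D_v ('D_w f) x - 'D_v ('D_w f) y| <= e / 2 &
    `|'D_w ('D_v f) x - 'D_w ('D_v f) y| <= e / 2]].
  apply/nbhs_ballP; apply: filterS3 nD (near_e v w) (near_e w v) => y.
  by split.
(* h K < r, so the parallelogram spanned by h v and h w stays in the ball. *)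
pose K : R := `|v| + `|w| + 1.
have K0 : 0 < K by rewrite ltr_wpDl ?addr_ge0.
pose h := r / (2 * K).
have h0 : 0 < h by rewrite divr_gt0 ?mulr_gt0.
have inb s t a b : `|a| + `|b| <= K -> 0 <= s <= h -> 0 <= t <= h ->
    ball x r (x + s *: a + t *: b).
  move=> abK /andP[s0 sh] /andP[t0 th]; rewrite -ball_normE /ball_ /=.
  rewrite -addrA opprD addNKr normrN (le_lt_trans (ler_normD _ _)) //.
  rewrite !normrZ (ger0_norm s0) (ger0_norm t0).
  apply: (@le_lt_trans _ _ (h * (`|a| + `|b|))).
    by rewrite mulrDr lerD // ler_wpM2r.
  apply: (@le_lt_trans _ _ (h * K)); first by rewrite ler_wpM2l // ltW.
  rewrite /h invfM mulrA -mulrA mulVf ?gt_eqF // mulr1.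
  by rewrite ltr_pdivrMr // ltr_pMr // ltr1n.
have vw : `|v| + `|w| <= K by rewrite lerDl.
have wv : `|w| + `|v| <= K by rewrite addrC lerDl.
have [s [t [sh th E1]]] := second_difference Cf h0
  (fun s t sh th => let: And3 d _ _ := Hr _ (inb s t v w vw sh th) in d).
have [s' [t' [sh' th' E2]]] := second_difference Cf h0
  (fun s t sh th => let: And3 d _ _ := Hr _ (inb s t w v wv sh th) in d).
have := Hr _ (inb _ _ _ _ vw sh th) => -[_ _ B1].
have := Hr _ (inb _ _ _ _ wv sh' th') => -[_ B2 _].
set y1 := 'D_w _ (x + s *: v + _) in E1 B1.
set y2 := 'D_v _ (x + s' *: w + _) in E2 B2.
clearbody y1 y2; have E : h * (h * y1) = h * (h * y2).
  rewrite -E1 -E2 [x + h *: w + h *: v]addrAC !opprB.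
  by rewrite addrACA [RHS]addrACA; congr (_ + _); exact: addrC.
have hn : h != 0 by rewrite gt_eqF.
have {}E := mulfI hn (mulfI hn E).
rewrite -(subrKA y2) [e]splitr (le_trans (ler_normD _ _)) // lerD //.
by rewrite distrC -E.
Qed.

End Segments.

(** * Gradients, Jacobians and Hessians *)

Section VectorCalculus.
Context {R : realType}.

Lemma dot_mx n (v w : 'cV[R]_n) : dot v w = (v^T *m w) 0 0.
Proof. by rewrite mxE; apply: eq_bigr => i _; rewrite mxE. Qed.

Lemma dotC n (v w : 'cV[R]_n) : dot v w = dot w v.
Proof. by apply: eq_bigr => i _; rewrite mulrC. Qed.

Lemma dotDl n (u v w : 'cV[R]_n) : dot (u + v) w = dot u w + dot v w.
Proof. by rewrite -big_split; apply: eq_bigr => i _; rewrite mxE mulrDl. Qed.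

Lemma dotDr n (u v w : 'cV[R]_n) : dot w (u + v) = dot w u + dot w v.
Proof. by rewrite dotC dotDl !(dotC w). Qed.

Lemma dotZl n a (v w : 'cV[R]_n) : dot (a *: v) w = a * dot v w.
Proof. by rewrite mulr_sumr; apply: eq_bigr => i _; rewrite mxE mulrA. Qed.

Lemma dotZr n a (v w : 'cV[R]_n) : dot w (a *: v) = a * dot w v.
Proof. by rewrite dotC dotZl dotC. Qed.

Lemma dotBl n (u v w : 'cV[R]_n) : dot (u - v) w = dot u w - dot v w.
Proof. by rewrite -scaleN1r dotDl dotZl mulN1r. Qed.

Lemma dotBr n (u v w : 'cV[R]_n) : dot w (u - v) = dot w u - dot w v.
Proof. by rewrite dotC dotBl !(dotC w). Qed.

Lemma evecE n (i k : 'I_n) : (evec i : 'cV[R]_n) k 0 = (k == i)%:R.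
Proof. by rewrite mxE eqxx andbT. Qed.

Lemma dot_evec n (v : 'cV[R]_n) i : dot v (evec i) = v i 0.
Proof.
rewrite /dot (bigD1 i) //= evecE eqxx mulr1 big1 ?addr0 // => k ki.
by rewrite evecE (negbTE ki) mulr0.
Qed.

Lemma cV_decomp n (v : 'cV[R]_n) : v = \sum_i v i 0 *: evec i.
Proof.
apply/colP => k; rewrite summxE (bigD1 k) //= !mxE !eqxx mulr1.
by rewrite big1 ?addr0 // => i ik; rewrite !mxE eq_sym (negbTE ik) mulr0.
Qed.

Lemma dot_inj n (v w : 'cV[R]_n) : (forall z, dot v z = dot w z) -> v = w.
Proof. by move=> vw; apply/colP => i; rewrite -!dot_evec. Qed.

Lemma is_derive_dot (V : normedModType R) n (F G : V -> 'cV[R]_n) x v :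
  differentiable F x -> differentiable G x ->
  is_derive x v (fun y => dot (F y) (G y))
    (dot ('D_v F x) (G x) + dot (F x) ('D_v G x)).
Proof.
move=> dF dG; rewrite /dot -big_split /=; apply: is_derive_sum_fun => i.
by apply: is_derive_mul; rewrite derive_mx_coord //;
  apply/is_derive_diff/differentiable_mx_coord.
Qed.

Lemma differentiable_dot (V : normedModType R) n (F G : V -> 'cV[R]_n) x :
  differentiable F x -> differentiable G x ->
  differentiable (fun y => dot (F y) (G y)) x.
Proof.
move=> dF dG; apply: differentiable_sum_fun => i.
by apply: differentiable_mul; exact: differentiable_mx_coord.
Qed.

Lemma derive_grad n (f : 'cV[R]_n -> R) x v :
  differentiable f x -> 'D_v f x = dot (grad f x) v.
Proof.
move=> df; rewrite deriveE // {1}(cV_decomp v) linear_sum; apply: eq_bigr => i _.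
by rewrite linearZ /= mxE deriveE // mulrC.
Qed.

Lemma derive_jac n m (F : 'cV[R]_n -> 'cV[R]_m) x v :
  differentiable F x -> 'D_v F x = jac F x *m v.
Proof.
move=> dF; apply/colP => i; rewrite derive_mx_coord // derive_grad.
  by rewrite mxE; apply: eq_bigr => j _; rewrite !mxE.
exact: differentiable_mx_coord.
Qed.

Lemma derive_jac_chain (V : normedModType R) n m (F : V -> 'cV[R]_n)
    (G : 'cV[R]_n -> 'cV[R]_m) x v :
  differentiable F x -> differentiable G (F x) ->
  'D_v (fun y => G (F y)) x = jac G (F x) *m 'D_v F x.
Proof. by move=> dF dG; rewrite derive_chain // derive_jac. Qed.

Lemma grad_coord n (f : 'cV[R]_n -> R) i :
  (fun y => grad f y i 0) = 'D_(evec i) f.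
Proof. by apply/funext => y; rewrite mxE. Qed.

Lemma hessE n (f : 'cV[R]_n -> R) x i j :
  hess f x i j = 'D_(evec j) ('D_(evec i) f) x.
Proof.
by rewrite mxE grad_coord.
Qed.

Lemma hess_sym n (D : set 'cV[R]_n) (f : 'cV[R]_n -> R) x :
  open D -> Ck 2 D f -> D x -> symmetric_mx (hess f x).
Proof.
move=> oD Cf Dx; apply/matrixP => i j; rewrite mxE !hessE.
exact: derive_comm oD Cf Dx.
Qed.

Lemma differentiable_gradient n (D : set 'cV[R]_n) (f : 'cV[R]_n -> R) x :
  Ck 2 D f -> D x -> differentiable (grad f) x.
Proof.
move=> [_ Cf] Dx; apply: differentiable_mx => i j; rewrite ord1.
rewrite grad_coord; exact: (Cf _).1.
Qed.

Lemma Ck_hess n (D : set 'cV[R]_n) (f : 'cV[R]_n -> R) i j :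
  Ck 2 D f -> Ck 0 D (fun x => hess f x i j).
Proof.
move=> [_ Cf]; rewrite (_ : (fun x => _) = 'D_(evec j) ('D_(evec i) f)).
  exact: (Cf _).2.
by apply/funext => x; rewrite hessE.
Qed.

Lemma posdef_unitmx n (A : 'M[R]_n) : posdef A -> A \in unitmx.
Proof.
move=> pA; rewrite -row_free_unit; apply: inj_row_free => v vA.
apply/eqP/negPn/negP => v0; have vT0 : v^T != 0.
  by apply: contra_neq v0 => /(congr1 trmx); rewrite trmxK trmx0.
by have := pA _ vT0; rewrite trmxK vA mul0mx mxE ltxx.
Qed.

(** With w = A^-1 v, the quadratic form of A^-1 at v is that of A at w. *)
Lemma posdef_invmx n (A : 'M[R]_n) : posdef A -> posdef (invmx A).
Proof.
move=> pA v v0; have uA := posdef_unitmx pA.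
have w0 : invmx A *m v != 0.
  by apply: contra_neq v0 => w0; rewrite -(mulKVmx uA v) w0 mulmx0.
set w := invmx A *m v in w0; have vw : v = A *m w by rewrite mulKVmx.
clearbody w.
have -> : v^T *m invmx A *m v = (w^T *m A *m w)^T.
  by rewrite {2}vw -mulmxA mulKmx // {1}vw !trmx_mul trmxK mulmxA.
by rewrite mxE; exact: pA.
Qed.

End VectorCalculus.

(** * Norm estimates, compact balls, inverse maps *)

Section Estimates.
Context {R : realType}.

Lemma norm_entry m n (A : 'M[R]_(m, n)) i j : `|A i j| <= `|A|.
Proof.
rewrite [leRHS]/Num.Def.normr /= mx_normrE; exact: (le_bigmax _ _ (i, j)).
Qed.

Lemma norm_mx_le m n (A : 'M[R]_(m, n)) c :
  0 <= c -> (forall i j, `|A i j| <= c) -> `|A| <= c.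
Proof.
by move=> c0 H; rewrite /Num.Def.normr /= mx_normrE (bigmax_le _ c0).
Qed.

Lemma norm_mulmx m n p (A : 'M[R]_(m, n)) (B : 'M[R]_(n, p)) :
  `|A *m B| <= n%:R * `|A| * `|B|.
Proof.
apply: norm_mx_le => [|i j]; first by rewrite !mulr_ge0.
rewrite mxE (le_trans (ler_norm_sum _ _ _)) //.
apply: (@le_trans _ _ (\sum_(k < n) (`|A| * `|B|))).
  by apply: ler_sum => k _; rewrite normrM ler_pM // norm_entry.
by rewrite sumr_const card_ord -mulrA mulr_natl.
Qed.

Lemma norm_trmx m n (A : 'M[R]_(m, n)) : `|A^T| = `|A|.
Proof.
apply/eqP; rewrite eq_le; apply/andP; split; apply: norm_mx_le => // i j.
  by rewrite mxE norm_entry.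
by rewrite (_ : A i j = A^T j i) ?norm_entry // mxE.
Qed.

Lemma norm_dot n (v w : 'cV[R]_n) : `|dot v w| <= n%:R * `|v| * `|w|.
Proof.
rewrite dot_mx (le_trans (norm_entry _ _ _)) // (le_trans (norm_mulmx _ _)) //.
by rewrite norm_trmx.
Qed.

Lemma differentiable_mulmxl m n p (A : 'M[R]_(m, n)) (x : 'M[R]_(n, p)) :
  differentiable (fun v : 'M[R]_(n, p) => A *m v) x.
Proof.
apply: differentiable_mx => i j.
rewrite (_ : (fun v => _) = fun v : 'M[R]_(n, p) => \sum_k A i k * v k j).
  apply: differentiable_sum_fun => k; apply: differentiable_mul => //.
  exact: differentiable_coord.
by apply/funext => v; rewrite mxE.
Qed.

Lemma compact_ball_cV n (a : 'cV[R]_n) (r : R) :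
  compact [set x | `|x - a| <= r].
Proof.
rewrite (_ : mkset _ = trmx @` [set y : 'rV[R]_n | `|y - a^T| <= r]).
  apply: continuous_compact.
    apply: continuous_subspaceT => y; apply: differentiable_continuous.
    apply: differentiable_mx => i j.
    rewrite (_ : (fun z => _) = fun z : 'rV[R]_n => z j i).
      exact: differentiable_coord.
    by apply/funext => z; rewrite mxE.
  apply: bounded_closed_compact.
    exists (r + `|a^T|); split; first exact: num_real.
    move=> M rM y /= yr; rewrite -(subrK a^T y) (le_trans (ler_normD _ _)) //.
    by rewrite (le_trans _ (ltW rM)) // lerD2r.
  rewrite (_ : mkset _ = closed_ball_ Num.norm a^T r).
    exact: closed_closed_ball_.
  by apply/funext => y; rewrite /closed_ball_ /= distrC.
apply/seteqP; split => [x /= xr|_ [y /= yr <-]].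
  by exists x^T; rewrite ?trmxK //= -linearB /= norm_trmx.
by rewrite -[a]trmxK -linearB /= norm_trmx.
Qed.

(** With Q = G U and a = G b, differentiability of F reads
    U - b = H (Q - a) + o(Q - a); the invertibility of H bounds Q - a by a multiple
    of U - b, so that Q - a = H^-1 (U - b) + o(U - b). *)
Lemma inverse_differentiable n (F G : 'cV[R]_n -> 'cV[R]_n) b :
  differentiable F (G b) -> jac F (G b) \in unitmx -> {for b, continuous G} ->
  (\near b, F (G b) = b) ->
  differentiable G b /\ forall v, 'D_v G b = invmx (jac F (G b)) *m v.
Proof.
move=> dF uH cG FG; set H := jac F (G b) in uH *; set a := G b in dF H uH *.
have Fa : F a = b by exact: nbhs_singleton FG.
pose C : R := n%:R * `|invmx H| + 1.
have C0 : 0 < C by rewrite ltr_wpDl // mulr_ge0.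
have HC (v : 'cV[R]_n) : `|invmx H *m v| <= C * `|v|.
  by rewrite (le_trans (norm_mulmx _ _)) // ler_wpM2r // lerDl.
apply: (@is_diff_of _ _ _ G (mulmx (invmx H))).
  by move=> v; apply/differentiable_continuous/differentiable_mulmxl.
apply/eqaddoP => e e0.
(* C e' <= 1/2 absorbs the error term into Q - a; 2 C C e' <= e gives the
   final estimate. *)
pose e' := Num.min (2 * C)^-1 (e / (2 * C * C)).
have e'0 : 0 < e' by rewrite lt_min invr_gt0 mulr_gt0 // divr_gt0 // !mulr_gt0.
have := diff_locally dF => /eqaddoP /(_ _ e'0) => near_F.
have cG0 (A : set 'cV[R]_n) : (\forall k \near (0 : 'cV[R]_n), A k) ->
    \forall h \near (0 : 'cV[R]_n), A (G (h + b) - a).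
  rewrite (near_shift a 0) => nA; have {}nA : \forall y \near b, A (G y - a).
    have nG : \forall y \near b, (A \o shift (0 - a)) (G y) by exact: cG nA.
    by apply: filterS nG => y /=; rewrite sub0r.
  by move: nA; rewrite (near_shift 0 b) subr0; apply: filterS.
have FG0 : \forall h \near (0 : 'cV[R]_n), F (G (h + b)) = h + b.
  by move: FG; rewrite (near_shift 0 b) subr0; apply: filterS => h.
move: FG0 (cG0 _ near_F); apply: filterS2 => h /= FGh.
rewrite -[X in `|X|]/(F (G (h + b) - a + a) - (F a + 'd F a (G (h + b) - a))).
rewrite subrK FGh Fa -deriveE // derive_jac // -/H => ho.
rewrite -[X in `|X|]/(G (h + b) - (a + invmx H *m h)).
set k := G (h + b) - a in ho *; rewrite opprD addrA -/k.
have {ho}kh : `|h - H *m k| <= e' * `|k|.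
  by move: ho; rewrite [h + b]addrC opprD addrACA subrr add0r.
have Ek : k - invmx H *m h = - (invmx H *m (h - H *m k)).
  by rewrite mulmxBr mulKmx // opprB.
have kle : `|k - invmx H *m h| <= C * e' * `|k|.
  rewrite Ek normrN (le_trans (HC _)) // -mulrA ler_wpM2l //; exact: ltW.
have Ce' : C * e' <= 2^-1.
  by rewrite -ler_pdivlMl // mulrC -invfM ge_min lexx.
have k2 : `|k| <= 2 * C * `|h|.
  have : `|k| <= 2^-1 * `|k| + C * `|h|.
    rewrite -[X in `|X| <= _](subrK (invmx H *m h) k) (le_trans (ler_normD _ _)) //.
    by rewrite lerD // (le_trans kle) // ler_wpM2r.
  by lra.
apply: (le_trans kle); apply: (@le_trans _ _ (C * e' * (2 * C * `|h|))).
  by rewrite ler_wpM2l // mulr_ge0 // ltW.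
rewrite mulrA ler_wpM2r // mulrAC mulrC -ler_pdivlMr; last first.
  by rewrite !mulr_gt0.
by rewrite ge_min [C * _]mulrC lexx orbT.
Qed.

End Estimates.

(** * The Legendre transform of a strictly convex function *)

Lemma convex_segment (R : realType) (V : normedModType R) (D : set V) :
  convex_set (D : set (convex_lmodType V)) ->
  forall x y (s : R), D x -> D y -> 0 <= s <= 1 -> D (x + s *: (y - x)).
Proof.
move=> cD x y s Dx Dy /andP[s0 s1].
have := cD y x (Itv01 s0 s1); rewrite !inE => /(_ Dy Dx).
suff -> : x + s *: (y - x) = conv (Itv01 s0 s1) (y : convex_lmodType V) x by [].
rewrite [RHS]/(s *: y + (1 - s) *: x) scalerBl scalerBr scale1r.
by rewrite addrC -addrA [- _ + _]addrC.
Qed.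

Lemma local_min_grad (R : realType) n (f : 'cV[R]_n -> R) (x : 'cV[R]_n) (r : R) :
  0 < r -> (forall y, `|y - x| < r -> differentiable f y) ->
  (forall y, `|y - x| < r -> f x <= f y) -> grad f x = 0.
Proof.
move=> r0 df fmin; apply/colP => i; rewrite !mxE.
pose h := r / (1 + `|evec i : 'cV[R]_n|).
have K0 : 0 < 1 + `|evec i : 'cV[R]_n| by rewrite ltr_pwDl.
have h0 : 0 < h by rewrite divr_gt0.
have inb (s : R) : s \in `](- h), h[ -> `|x + s *: evec i - x| < r.
  rewrite in_itv /= -ltr_norml addrC addKr normrZ => sh.
  apply: (@le_lt_trans _ _ (`|s| * (1 + `|evec i : 'cV[R]_n|))).
    by rewrite ler_wpM2l // lerDr.
  by rewrite -ltr_pdivlMr.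
have d0 (s : R) : s \in `](- h), h[ -> differentiable f (x + s *: evec i).
  by move=> /inb; exact: df.
have dl (s : R) sh := is_derive_line (d0 s sh).
have z0 : (0 : R) \in `](- h), h[ by rewrite in_itv /= oppr_lt0 h0.
have := @derive1_at_min _ (fun s : R => f (x + s *: evec i)) (- h) h 0.
case=> //.
- by rewrite ge0_cp // ltW.
- by move=> s /dl[].
- by move=> s sh; rewrite scale0r addr0; exact/fmin/inb.
move=> _ <-; apply/esym/is_derive_val.
by have := dl _ z0; rewrite scale0r addr0.
Qed.

Section Legendre.
Context {R : realType} {n : nat} (D : set 'cV[R]_n) (E : 'cV[R]_n -> R).
Hypothesis oD : open D.
Hypothesis cD : convex_set (D : set (convex_lmodType 'cV[R]_n)).
Hypothesis CE : Ck 2 D E.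
Hypothesis pE : forall Q, D Q -> posdef (hess E Q).

Let dE Q : D Q -> differentiable E Q.
Proof. exact: CE.1. Qed.

Let dgE Q : D Q -> differentiable (grad E) Q.
Proof. exact: differentiable_gradient. Qed.

(** The derivative of grad E . (y - x) along the segment from x to y is the
    quadratic form of the Hessian at y - x. *)
Lemma grad_strictly_monotone x y : D x -> D y -> x != y ->
  0 < dot (grad E y - grad E x) (y - x).
Proof.
move=> Dx Dy xy; pose f Q := dot (grad E Q) (y - x).
have df Q : D Q -> is_derive Q (y - x) f
    (((y - x)^T *m hess E Q *m (y - x)) 0 0).
  move=> DQ; apply: (is_derive_eq (is_derive_dot (y - x) (dgE DQ)
    (differentiable_cst (y - x) Q))).
  rewrite derive_cst derive_jac; last exact: dgE.
  rewrite [dot _ 0]dot_mx mulmx0 [X in _ + X]mxE addr0 dotC dot_mx.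
  by rewrite mulmxA.
have [s s01 Es] : exists2 s, 0 < s < 1 &
    f (x + 1 *: (y - x)) - f x = 1 * 'D_(y - x) f (x + s *: (y - x)).
  apply: segment_MVT => // s s01; apply: differentiable_dot => //.
  by apply: dgE; exact: convex_segment.
have Ds : D (x + s *: (y - x)).
  by apply: convex_segment => //; case/andP: s01 => ? ?; rewrite !ltW.
rewrite dotBl -/(f x); move: Es; rewrite scale1r [x + _]addrC subrK => ->.
rewrite mul1r (is_derive_val (df _ Ds)).
by apply: pE => //; rewrite subr_eq0 eq_sym.
Qed.

Lemma grad_inj : {in D &, injective (grad E)}.
Proof.
move=> x y; rewrite !inE => Dx Dy gxy; apply/eqP/negPn/negP => xy.
have := grad_strictly_monotone Dx Dy xy.
by rewrite gxy subrr dot_mx trmx0 mul0mx mxE ltxx.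
Qed.

(** The derivative of E minus its tangent at x, along the segment from x to y, is
    positive by monotonicity of the gradient. *)
Lemma tangent_below x y : D x -> D y -> x != y ->
  0 < E y - E x - dot (grad E x) (y - x).
Proof.
move=> Dx Dy xy; pose f Q := E Q - dot (grad E x) Q.
have df Q : D Q -> differentiable f Q.
  move=> DQ; apply: differentiableB; first exact: dE.
  by apply: differentiable_dot.
have [s s01 Es] : exists2 s, 0 < s < 1 &
    f (x + 1 *: (y - x)) - f x = 1 * 'D_(y - x) f (x + s *: (y - x)).
  by apply: segment_MVT => // s s01; apply: df; exact: convex_segment.
have /andP[s0 s1] := s01.
set z := x + s *: (y - x) in Es *.
have Dz : D z by apply: convex_segment => //; rewrite !ltW.
have xz : x != z.
  rewrite -subr_eq0 opprD addNKr oppr_eq0 scaler_eq0 negb_or gt_eqF //=.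
  by rewrite subr_eq0 eq_sym.
have Dfz : 'D_(y - x) f z = dot (grad E z - grad E x) (y - x).
  rewrite (is_derive_val (is_derive_sub (is_derive_diff (y - x) (dE Dz))
    (is_derive_dot (y - x) (differentiable_cst (grad E x) z)
    (differentiable_id z)))).
  rewrite derive_cst derive_id derive_grad; last exact: dE.
  by rewrite dotBl [dot 0 _]dot_mx trmx0 mul0mx [X in _ - (X + _)]mxE add0r.
have -> : E y - E x - dot (grad E x) (y - x) = 'D_(y - x) f z.
  by rewrite -[RHS]mul1r -Es scale1r [x + _]addrC subrK /f dotBr; ring.
have := grad_strictly_monotone Dx Dz xz.
have zx : z - x = s *: (y - x) by rewrite /z [x + _]addrC addrK.
by rewrite Dfz zx dotZr pmulr_rgt0.
Qed.

(** The function E - U.Q attains its minimum over a small closed ball around Q0;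
    for U = grad E Q0 its values on the sphere exceed the value at the centre by a
    fixed amount, so for U close to grad E Q0 the minimum is interior, hence a
    critical point, that is a solution of grad E Q = U. *)
Lemma grad_locally_onto Q0 (r : R) : D Q0 -> 0 < r ->
  (forall Q, `|Q - Q0| <= r -> D Q) ->
  \forall U \near grad E Q0, exists2 Q, `|Q - Q0| < r & grad E Q = U.
Proof.
move=> DQ0 r0 rD.
pose B := [set Q : 'cV[R]_n | `|Q - Q0| <= r].
pose S := B `&` [set Q | r <= `|Q - Q0|].
pose g Q := E Q - E Q0 - dot (grad E Q0) (Q - Q0).
have cB : compact B by exact: compact_ball_cV.
have contN : continuous (fun Q : 'cV[R]_n => `|Q - Q0|).
  move=> Q.
  have h : {for Q, continuous (fun Q : 'cV[R]_n => Q - Q0)}.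
    by apply: differentiable_continuous; exact: differentiableB.
  exact: (cvg_norm h).
have cS : compact S.
  apply: compact_closedI => //.
  rewrite (_ : mkset _ = (fun Q => `|Q - Q0|) @^-1` [set s | r <= s]) //.
  by apply: closed_comp; [move=> Q _; exact: contN|exact: closed_ge].
have dg Q : D Q -> differentiable g Q.
  move=> DQ; apply: differentiableB; last exact: differentiable_dot.
  by apply: differentiableB => //; exact: dE.
have [c c0 Hc] : exists2 c : R, 0 < c & forall Q, S Q -> c <= g Q.
  (* The sphere is empty when n = 0. *)
  have [S0|nS] := pselect (S !=set0); last first.
    by exists 1 => // Q SQ; exfalso; apply: nS; exists Q.
  have [|Q QS Qmin] := compact_EVT_min (f := g) S0 cS.
    apply: continuous_in_subspaceT => Q; rewrite inE => -[BQ _].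
    exact/differentiable_continuous/dg/rD.
  move: QS; rewrite inE => -[BQ rQ].
  exists (g Q); last by move=> Q' SQ'; apply: Qmin; rewrite inE.
  apply: tangent_below => //; first exact: rD.
  by apply: contraTneq rQ => <-; rewrite /= subrr normr0 -ltNge.
(* Replacing grad E Q0 by U changes the function by at most K |U - grad E Q0|
   on the ball. *)
pose K : R := n%:R * r + 1.
have K0 : 0 < K by rewrite ltr_wpDl // mulr_ge0 // ltW.
have near_U : \forall U \near grad E Q0, `|U - grad E Q0| < c / K.
  have cK : 0 < c / K by rewrite divr_gt0.
  apply/nbhs_ballP; exists (c / K) => //= U; rewrite -ball_normE /ball_ /=.
  by rewrite distrC.
apply: filterS near_U => U HU.
pose F Q := E Q - dot U Q.
have dF Q : D Q -> differentiable F Q.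
  by move=> DQ; apply: differentiableB; [exact: dE|exact: differentiable_dot].
have B0 : B !=set0 by exists Q0; rewrite /B /= subrr normr0 ltW.
have [|Q QB Qmin] := compact_EVT_min (f := F) B0 cB.
  apply: continuous_in_subspaceT => Q; rewrite inE => BQ.
  exact/differentiable_continuous/dF/rD.
have BQ : B Q by move: QB; rewrite inE.
have FE Q' : F Q' - F Q0 = g Q' - dot (U - grad E Q0) (Q' - Q0).
  by rewrite /F /g !(dotBl, dotBr); ring.
have Qr : `|Q - Q0| < r.
  rewrite ltNge; apply/negP => rQ.
  have cg : c <= g Q by apply: Hc; split.
  have Q0B : Q0 \in B by rewrite inE /B /= subrr normr0 ltW.
  have := Qmin _ Q0B.
  rewrite -subr_le0 FE subr_le0 leNgt => /negP; apply.
  apply: lt_le_trans cg; apply: (le_lt_trans (ler_norm _)).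
  apply: (le_lt_trans (norm_dot _ _)).
  apply: (@le_lt_trans _ _ (`|U - grad E Q0| * K)).
    rewrite mulrAC [leRHS]mulrC ler_wpM2r //.
    apply: (@le_trans _ _ (n%:R * r)); first by rewrite ler_wpM2l.
    by rewrite lerDl.
  by rewrite -ltr_pdivlMr.
exists Q => //.
have rQ0 : 0 < r - `|Q - Q0| by rewrite subr_gt0.
have inB Q' : `|Q' - Q| < r - `|Q - Q0| -> B Q'.
  rewrite ltrBrDr => QQ; rewrite /B /= -(subrKA Q).
  by rewrite (le_trans (ler_normD _ _)) // ltW.
have gF : grad F Q = 0.
  apply: local_min_grad rQ0 _ _ => Q' /inB BQ'; first exact/dF/rD.
  by apply: Qmin; rewrite inE.
apply: dot_inj => z; apply/eqP; rewrite -subr_eq0; apply/eqP.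
have DQ : D Q by exact: rD.
transitivity (dot (grad F Q) z); last by rewrite gF dot_mx trmx0 mul0mx mxE.
rewrite -(derive_grad z (dF Q DQ)).
rewrite (is_derive_val (is_derive_sub (is_derive_diff z (dE DQ))
    (is_derive_dot z (differentiable_cst U Q) (differentiable_id Q)))).
rewrite derive_cst derive_id derive_grad; last exact: dE.
by rewrite [dot 0 _]dot_mx trmx0 mul0mx [X in _ = _ - (X + _)]mxE add0r.
Qed.

Let DU := grad E @` D.

Lemma open_closed_ball_sub (Q : 'cV[R]_n) : D Q ->
  exists2 r : R, 0 < r & forall Q', `|Q' - Q| <= r -> D Q'.
Proof.
move=> DQ; have : nbhs Q D by exact: open_nbhs_nbhs.
move=> /nbhs_ballP[r /= r0 rD]; exists (r / 2); first by rewrite divr_gt0.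
move=> Q' QQ; apply: rD; rewrite -ball_normE /ball_ /= distrC.
by rewrite (le_lt_trans QQ) // ltr_pdivrMr // ltr_pMr // ltr1n.
Qed.

Lemma open_grad_image : open DU.
Proof.
rewrite openE => _ [Q DQ <-]; rewrite /interior.
have [r r0 rD] := open_closed_ball_sub DQ.
apply: filterS (grad_locally_onto DQ r0 rD) => U [Q' Qr <-].
by exists Q' => //; apply: rD; exact: ltW.
Qed.

Lemma state_ofK Q : D Q -> state_of D E (grad E Q) = Q.
Proof.
move=> DQ; rewrite /state_of; case: xgetP => [Q' _ [DQ' EQ]|/(_ Q)[]//].
by apply: grad_inj; rewrite ?inE.
Qed.

Lemma state_of_in U : DU U -> D (state_of D E U).
Proof. by move=> [Q DQ <-]; rewrite state_ofK. Qed.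

Lemma grad_state_of U : DU U -> grad E (state_of D E U) = U.
Proof. by move=> [Q DQ <-]; rewrite state_ofK. Qed.

(** By local surjectivity on arbitrarily small balls around Q0, conjugate
    variables close to grad E Q0 have a preimage close to Q0, and this preimage is
    the only one. *)
Lemma continuous_state_of U : DU U -> {for U, continuous (state_of D E)}.
Proof.
move=> [Q0 DQ0 <-]; rewrite /prop_for /continuous_at state_ofK //.
apply: (iffRL (@cvgrPdist_lt _ _ _ (nbhs (grad E Q0)) _ _ _)) => e e0.
have [r r0 rD] := open_closed_ball_sub DQ0.
have m0 : 0 < Num.min e r by rewrite lt_min e0 r0.
have mD Q : `|Q - Q0| <= Num.min e r -> D Q.
  by rewrite le_min => /andP[_]; exact: rD.
apply: filterS (grad_locally_onto DQ0 m0 mD) => W [Q Qm <-].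
have DQ : D Q by apply: mD; exact: ltW.
by rewrite (state_ofK DQ) -normrN opprB; move: Qm; rewrite lt_min => /andP[].
Qed.

Lemma jac_gradE Q : jac (grad E) Q = hess E Q. Proof. by []. Qed.

Lemma derive_state_of U : DU U -> differentiable (state_of D E) U /\
  forall v, 'D_v (state_of D E) U = invmx (hess E (state_of D E U)) *m v.
Proof.
move=> UU; rewrite -jac_gradE; apply: inverse_differentiable.
- exact/dgE/state_of_in.
- by apply: posdef_unitmx; exact/pE/state_of_in.
- exact: continuous_state_of.
- apply: filterS (open_nbhs_nbhs (conj open_grad_image UU)) => W.
  exact: grad_state_of.
Qed.

(** The derivative of U.Q(U) - E(Q(U)) is Q(U) because the terms containing the
    derivative of Q(U) cancel, as grad E (Q(U)) = U. *)
Lemma is_derive_legendre U v : DU U ->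
  is_derive U v (legendre D E) (dot (state_of D E U) v).
Proof.
move=> UU; have [dQ _] := derive_state_of UU; have DQ := state_of_in UU.
have dEQ : differentiable (fun W => E (state_of D E W)) U.
  by apply: (differentiable_comp dQ); exact: dE.
have := is_derive_sub (is_derive_dot v (differentiable_id U) dQ)
  (is_derive_diff v dEQ).
move/is_derive_eq; apply; rewrite derive_id derive_chain ?derive_grad //.
- by rewrite grad_state_of // [dot v _]dotC addrK.
- exact: dE.
- exact: dE.
Qed.

Lemma differentiable_legendre U : DU U -> differentiable (legendre D E) U.
Proof.
move=> UU; have [dQ _] := derive_state_of UU.
apply: differentiableB; first exact: differentiable_dot.
by apply: (differentiable_comp dQ); exact/dE/state_of_in.
Qed.

Lemma derive_legendre U v : DU U ->
  'D_v (legendre D E) U = dot (state_of D E U) v.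
Proof. by move=> UU; exact/is_derive_val/is_derive_legendre. Qed.

Lemma grad_legendre U : DU U -> grad (legendre D E) U = state_of D E U.
Proof.
by move=> UU; apply/colP => i; rewrite mxE derive_legendre // dot_evec.
Qed.

Lemma hess_legendre U : DU U ->
  hess (legendre D E) U = invmx (hess E (state_of D E U)).
Proof.
move=> UU; have [dQ DQ] := derive_state_of UU.
apply/matrixP => i j; rewrite mxE.
have nU : \near U, grad (legendre D E) U i 0 = state_of D E U i 0.
  apply: filterS (open_nbhs_nbhs (conj open_grad_image UU)) => W WU.
  by rewrite grad_legendre.
rewrite (near_eq_derive _ nU) -derive_mx_coord // DQ.
by rewrite -colE mxE.
Qed.

(** The second derivatives of the transform are the entries of the inverse of the
    Hessian of E at Q(U), which are continuous in U. *)
Lemma Ck2_legendre : Ck 2 DU (legendre D E).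
Proof.
have oU := open_grad_image; split=> [U|v]; first exact: differentiable_legendre.
have Cv : Ck 1 DU (fun U => dot (state_of D E U) v).
  split=> [U UU|w].
    by apply: differentiable_dot => //; exact: (derive_state_of UU).1.
  have CH i j : Ck 0 DU (fun U => invmx (hess E (state_of D E U)) i j).
    apply: Ck_invmx => // [U UU|a b U UU].
      by apply: posdef_unitmx; exact/pE/state_of_in.
    apply: (@continuous_comp _ _ _ (state_of D E) (fun Q => hess E Q a b)).
      exact: continuous_state_of.
    have CHab : Ck 0 D (fun Q => hess E Q a b) by exact: Ck_hess CE.
    exact: (CHab _ (state_of_in UU)).
  have C0 : Ck 0 DU (fun U =>
      \sum_i \sum_j invmx (hess E (state_of D E U)) i j * (w j 0 * v i 0)).
    apply: Ck_sum => // i; apply: Ck_sum => // j; apply: Ck_mul => //.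
    exact: Ck_cst.
  apply: Ck_ext C0 => // U UU; have [dQ DQ] := derive_state_of UU.
  rewrite (is_derive_val (is_derive_dot w dQ (differentiable_cst v U))).
  rewrite derive_cst [dot _ 0]dot_mx mulmx0 [X in _ + X]mxE addr0 DQ.
  apply: eq_bigr => i _; rewrite mxE mulr_suml; apply: eq_bigr => j _.
  by rewrite mulrA.
by apply: Ck_ext Cv => // U UU; rewrite derive_legendre.
Qed.

Lemma legendre_friedrichs U : DU U ->
  symmetric_mx (hess (legendre D E) U) /\ posdef (hess (legendre D E) U).
Proof.
move=> UU; split; first exact: hess_sym open_grad_image Ck2_legendre UU.
by rewrite hess_legendre //; apply: posdef_invmx; exact/pE/state_of_in.
Qed.

Lemma legendre_grad Q : D Q ->
  legendre D E (grad E Q) = dot (grad E Q) Q - E Q.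
Proof. by move=> DQ; rewrite /legendre state_ofK. Qed.

End Legendre.

(** * Block decomposition of states *)

Section States.
Context {R : realType} {d : nat}.
Implicit Types X Y : state R d.

(** The row indices of the four blocks in a state vector. *)
Definition pos1 : 'I_(dimS d) := lshift (d + (1 + d)) 0.
Definition pos2 (k : 'I_d) : 'I_(dimS d) := rshift 1 (lshift (1 + d) k).
Definition pos3 : 'I_(dimS d) := rshift 1 (rshift d (lshift d 0)).
Definition pos4 (k : 'I_d) : 'I_(dimS d) := rshift 1 (rshift d (rshift 1 k)).

Lemma blk1E X : blk1 X = X pos1 0. Proof. by rewrite /blk1 mxE. Qed.
Lemma blk2E X k : blk2 X k 0 = X (pos2 k) 0.
Proof. by rewrite /blk2 !mxE. Qed.
Lemma blk3E X : blk3 X = X pos3 0. Proof. by rewrite /blk3 !mxE. Qed.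
Lemma blk4E X k : blk4 X k 0 = X (pos4 k) 0.
Proof. by rewrite /blk4 !mxE. Qed.

Lemma blk1_mkstate a v b w : blk1 (mkstate a v b w : state R d) = a.
Proof. by rewrite /blk1 col_mxKu mxE. Qed.
Lemma blk2_mkstate a v b w : blk2 (mkstate a v b w : state R d) = v.
Proof. by rewrite /blk2 col_mxKd col_mxKu. Qed.
Lemma blk3_mkstate a v b w : blk3 (mkstate a v b w : state R d) = b.
Proof. by rewrite /blk3 !col_mxKd col_mxKu mxE. Qed.
Lemma blk4_mkstate a v b w : blk4 (mkstate a v b w : state R d) = w.
Proof. by rewrite /blk4 !col_mxKd. Qed.

Definition blk_mkstate :=
  (blk1_mkstate, blk2_mkstate, blk3_mkstate, blk4_mkstate).

Lemma state_eqP X Y : blk1 X = blk1 Y -> blk2 X = blk2 Y ->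
  blk3 X = blk3 Y -> blk4 X = blk4 Y -> X = Y.
Proof.
rewrite /blk1 /blk2 /blk3 /blk4 => e1 e2 e3 e4.
rewrite -[X]vsubmxK -[Y]vsubmxK; congr col_mx.
  by apply/colP => i; rewrite ord1.
rewrite -[dsubmx X]vsubmxK -[dsubmx Y]vsubmxK e2; congr col_mx.
rewrite -[dsubmx (dsubmx X)]vsubmxK -[dsubmx (dsubmx Y)]vsubmxK e4.
by congr col_mx; apply/colP => i; rewrite ord1.
Qed.

Lemma blk1D X Y : blk1 (X + Y) = blk1 X + blk1 Y.
Proof. by rewrite !blk1E mxE. Qed.
Lemma blk2D X Y : blk2 (X + Y) = blk2 X + blk2 Y.
Proof. by apply/colP => k; rewrite blk2E [LHS]mxE [RHS]mxE !blk2E. Qed.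
Lemma blk3D X Y : blk3 (X + Y) = blk3 X + blk3 Y.
Proof. by rewrite !blk3E mxE. Qed.
Lemma blk4D X Y : blk4 (X + Y) = blk4 X + blk4 Y.
Proof. by apply/colP => k; rewrite blk4E [LHS]mxE [RHS]mxE !blk4E. Qed.

Definition blkD := (blk1D, blk2D, blk3D, blk4D).

Lemma blk1Z a X : blk1 (a *: X) = a * blk1 X.
Proof. by rewrite !blk1E mxE. Qed.
Lemma blk2Z a X : blk2 (a *: X) = a *: blk2 X.
Proof. by apply/colP => k; rewrite blk2E [LHS]mxE [RHS]mxE !blk2E. Qed.
Lemma blk3Z a X : blk3 (a *: X) = a * blk3 X.
Proof. by rewrite !blk3E mxE. Qed.
Lemma blk4Z a X : blk4 (a *: X) = a *: blk4 X.
Proof. by apply/colP => k; rewrite blk4E [LHS]mxE [RHS]mxE !blk4E. Qed.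

Definition blkZ := (blk1Z, blk2Z, blk3Z, blk4Z).

Lemma blk1_sum n (F : 'I_n -> state R d) :
  blk1 (\sum_i F i) = \sum_i blk1 (F i).
Proof. by rewrite blk1E summxE; apply: eq_bigr => i _; rewrite blk1E. Qed.
Lemma blk2_sum n (F : 'I_n -> state R d) :
  blk2 (\sum_i F i) = \sum_i blk2 (F i).
Proof.
apply/colP => k; rewrite blk2E [LHS]summxE [RHS]summxE.
apply: eq_bigr => i _.
by rewrite blk2E.
Qed.
Lemma blk3_sum n (F : 'I_n -> state R d) :
  blk3 (\sum_i F i) = \sum_i blk3 (F i).
Proof. by rewrite blk3E summxE; apply: eq_bigr => i _; rewrite blk3E. Qed.
Lemma blk4_sum n (F : 'I_n -> state R d) :
  blk4 (\sum_i F i) = \sum_i blk4 (F i).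
Proof.
apply/colP => k; rewrite blk4E [LHS]summxE [RHS]summxE.
apply: eq_bigr => i _.
by rewrite blk4E.
Qed.

Definition blk_sum := (blk1_sum, blk2_sum, blk3_sum, blk4_sum).

Lemma dot_state X Y : dot X Y = blk1 X * blk1 Y + dot (blk2 X) (blk2 Y)
  + blk3 X * blk3 Y + dot (blk4 X) (blk4 Y).
Proof.
rewrite [dot X Y]/dot big_split_ord /= big_split_ord /= big_split_ord /=.
rewrite !big_ord1 -/pos1 -/pos3 -!blk1E -!blk3E !addrA; congr (_ + _ + _ + _).
  by apply: eq_bigr => k _; rewrite !blk2E.
by apply: eq_bigr => k _; rewrite !blk4E.
Qed.

Section Fields.
Context {V : normedModType R} (F : V -> state R d) (x : V).
Hypothesis dF : differentiable F x.

Lemma differentiable_blk1 : differentiable (fun y => blk1 (F y)) x.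
Proof.
rewrite (_ : (fun y => _) = fun y => F y pos1 0).
  exact: differentiable_mx_coord.
by apply/funext => y; rewrite blk1E.
Qed.

Lemma differentiable_blk2 : differentiable (fun y => blk2 (F y)) x.
Proof.
apply: differentiable_mx => k i; rewrite ord1.
rewrite (_ : (fun y => _) = fun y => F y (pos2 k) 0).
  exact: differentiable_mx_coord.
by apply/funext => y; rewrite blk2E.
Qed.

Lemma differentiable_blk3 : differentiable (fun y => blk3 (F y)) x.
Proof.
rewrite (_ : (fun y => _) = fun y => F y pos3 0).
  exact: differentiable_mx_coord.
by apply/funext => y; rewrite blk3E.
Qed.

Lemma differentiable_blk4 : differentiable (fun y => blk4 (F y)) x.
Proof.
apply: differentiable_mx => k i; rewrite ord1.
rewrite (_ : (fun y => _) = fun y => F y (pos4 k) 0).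
  exact: differentiable_mx_coord.
by apply/funext => y; rewrite blk4E.
Qed.

Lemma derive_blk1 v : 'D_v (fun y => blk1 (F y)) x = blk1 ('D_v F x).
Proof.
have -> : (fun y => blk1 (F y)) = fun y => F y pos1 0.
  by apply/funext => y; rewrite blk1E.
by rewrite blk1E derive_mx_coord.
Qed.

Lemma derive_blk2 v : 'D_v (fun y => blk2 (F y)) x = blk2 ('D_v F x).
Proof.
apply/colP => k; rewrite (derive_mx_coord _ _ _ differentiable_blk2).
have -> : (fun y => blk2 (F y) k 0) = fun y => F y (pos2 k) 0.
  by apply/funext => y; rewrite blk2E.
by rewrite blk2E derive_mx_coord.
Qed.

Lemma derive_blk3 v : 'D_v (fun y => blk3 (F y)) x = blk3 ('D_v F x).
Proof.
have -> : (fun y => blk3 (F y)) = fun y => F y pos3 0.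
  by apply/funext => y; rewrite blk3E.
by rewrite blk3E derive_mx_coord.
Qed.

Lemma derive_blk4 v : 'D_v (fun y => blk4 (F y)) x = blk4 ('D_v F x).
Proof.
apply/colP => k; rewrite (derive_mx_coord _ _ _ differentiable_blk4).
have -> : (fun y => blk4 (F y) k 0) = fun y => F y (pos4 k) 0.
  by apply/funext => y; rewrite blk4E.
by rewrite blk4E derive_mx_coord.
Qed.

End Fields.

Lemma differentiable_mkstate (V : normedModType R) (a b : V -> R)
    (v w : V -> 'cV[R]_d) x :
  differentiable a x -> differentiable v x -> differentiable b x ->
  differentiable w x ->
  differentiable (fun y => mkstate (a y) (v y) (b y) (w y)) x.
Proof.
move=> da dv db dw; apply: differentiable_mx => i j; rewrite ord1 => {j}.
rewrite /mkstate; case: (splitP i) => [k ik|k ik].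
  have -> : i = pos1 by apply: val_inj; rewrite /= ik ord1.
  rewrite (_ : (fun y => _) = a) //; apply/funext => y.
  by rewrite -blk1E blk1_mkstate.
case: (splitP k) => [l kl|l kl].
  have -> : i = pos2 l by apply: val_inj; rewrite /= ik kl.
  rewrite (_ : (fun y => _) = fun y => v y l 0).
    exact: differentiable_mx_coord.
  by apply/funext => y; rewrite -blk2E blk2_mkstate.
case: (splitP l) => [p lp|p lp].
  have -> : i = pos3 by apply: val_inj; rewrite /= ik kl lp ord1.
  rewrite (_ : (fun y => _) = b) //; apply/funext => y.
  by rewrite -blk3E blk3_mkstate.
have -> : i = pos4 p by apply: val_inj; rewrite /= ik kl lp.
rewrite (_ : (fun y => _) = fun y => w y p 0).
  exact: differentiable_mx_coord.
by apply/funext => y; rewrite -blk4E blk4_mkstate.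
Qed.

End States.

(** * The energy and its conjugate variables *)

Section Energy.
Context {R : realType} {d : nat} (eps : R -> R -> R) (alpha : R -> R).
Variable D : set (state R d).
Hypothesis oD : open D.
Hypothesis rho_gt0 : forall Q, D Q -> 0 < blk1 Q.
Hypothesis eps_smooth : smooth (thermo D) (fun z : R * R => eps z.1 z.2).
Hypothesis alpha_smooth : smooth [set r : R | 0 < r] alpha.

Let E : state R d -> R := energy eps alpha.

Lemma Ck_energy k : Ck k D E.
Proof.
have C1 : Ck k D (@blk1 R d).
  by apply: Ck_ext (Ck_coord k D pos1 0) => // Q _; rewrite blk1E.
have C3 : Ck k D (@blk3 R d).
  by apply: Ck_ext (Ck_coord k D pos3 0) => // Q _; rewrite blk3E.
have Cd (f : state R d -> 'cV[R]_d) (p : 'I_d -> 'I_(dimS d)) :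
    (forall Q i, f Q i 0 = Q (p i) 0) -> Ck k D (fun Q => dot (f Q) (f Q)).
  move=> fp; apply: Ck_sum => // i; apply: Ck_mul => //;
  by apply: Ck_ext (Ck_coord k D (p i) 0) => // Q _; rewrite fp.
have Crho : Ck k D (fun Q => (blk1 Q)^-1).
  by apply: Ck_inv => // Q DQ; rewrite gt_eqF // rho_gt0.
apply: Ck_add => //; first apply: Ck_add => //.
- apply: Ck_mul => //; last exact: Cd (@blk2E R d).
  apply: Ck_inv => //; first by move=> Q /rho_gt0 r0; rewrite gt_eqF // mulr_gt0.
  by apply: Ck_mul => //; exact: Ck_cst.
- apply: Ck_mul => //.
  apply: (Ck_comp2 (T := thermo D) (f := fun z => eps z.1 z.2)
    (g1 := @blk1 R d) (g2 := fun Q => blk3 Q / blk1 Q)) => //.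
  + by move=> Q DQ; exists Q.
  + exact: Ck_mul.
- apply: Ck_mul => //; last exact: Cd (@blk4E R d).
  apply: Ck_mul => //; first exact: Ck_cst.
  by apply: (Ck_comp1 (T := [set r : R | 0 < r]) (f := alpha)
    (g := @blk1 R d)).
Qed.

Lemma derive_fst (a b : R) :
  'D_(1, 0) (fun z : R * R => eps z.1 z.2) (a, b) =
  derive1 (fun r => eps r b) a.
Proof.
rewrite derive1E /derive; set g1 := fun h => h^-1 *: _.
set g2 := fun h => h^-1 *: _; suff -> : g1 = g2 by [].
by apply/funext => h; rewrite /g1 /g2 /= -[h *: 0]/(h * 0) mulr0 add0r.
Qed.

Lemma derive_snd (a b : R) :
  'D_(0, 1) (fun z : R * R => eps z.1 z.2) (a, b) = derive1 (eps a) b.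
Proof.
rewrite derive1E /derive; set g1 := fun h => h^-1 *: _.
set g2 := fun h => h^-1 *: _; suff -> : g1 = g2 by [].
by apply/funext => h; rewrite /g1 /g2 /= -[h *: 0]/(h * 0) mulr0 add0r.
Qed.

(** The derivative of the energy in rho with m, s and j fixed; the term in the
    temperature comes from the dependence of eta = s / rho on rho. *)
Definition chemical_potential (Q : state R d) : R :=
  let rho := blk1 Q in let eta := blk3 Q / rho in
  - dot (blk2 Q) (blk2 Q) / (2 * rho ^+ 2)
  + eps rho eta + rho * derive1 (fun r => eps r eta) rho
  - eta * temperature eps rho eta
  + 2^-1 * derive1 alpha rho * dot (blk4 Q) (blk4 Q).

Lemma grad_energy Q : D Q -> grad E Q =
  mkstate (chemical_potential Q) ((blk1 Q)^-1 *: blk2 Q)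
    (temperature eps (blk1 Q) (blk3 Q / blk1 Q)) (alpha (blk1 Q) *: blk4 Q).
Proof.
move=> DQ; have r0 := rho_gt0 DQ; have rn0 : blk1 Q != 0 by rewrite gt_eqF.
apply: dot_inj => v; rewrite -derive_grad; last first.
  by apply: Ck_differentiable DQ; exact: (Ck_energy 1).
have dI := differentiable_id Q.
have h1 : is_derive Q v (@blk1 R d) (blk1 v).
  have := is_derive_diff v (differentiable_blk1 dI).
  by rewrite derive_blk1 // derive_id.
have h3 : is_derive Q v (@blk3 R d) (blk3 v).
  have := is_derive_diff v (differentiable_blk3 dI).
  by rewrite derive_blk3 // derive_id.
have h22 := is_derive_dot v (differentiable_blk2 dI) (differentiable_blk2 dI).
have h44 := is_derive_dot v (differentiable_blk4 dI) (differentiable_blk4 dI).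
rewrite derive_blk2 // derive_id in h22; rewrite derive_blk4 // derive_id in h44.
have hi := is_derive_inv rn0 h1.
have heta := is_derive_mul h3 hi.
have d1 : differentiable (@blk1 R d) Q by exact: differentiable_blk1.
have deta : differentiable (fun Q => blk3 Q / blk1 Q) Q.
  apply: differentiable_mul; first exact: differentiable_blk3.
  exact: differentiableV.
have TQ : thermo D (blk1 Q, blk3 Q / blk1 Q) by exists Q.
have deps : differentiable (fun z : R * R => eps z.1 z.2) (blk1 Q, blk3 Q / blk1 Q).
  exact: Ck_differentiable (eps_smooth 1) TQ.
have heps : is_derive Q v (fun Q => eps (blk1 Q) (blk3 Q / blk1 Q))
    (blk1 v * derive1 (fun r => eps r (blk3 Q / blk1 Q)) (blk1 Q) +
     (blk3 v * (blk1 Q)^-1 + blk3 Q * (- blk1 v / blk1 Q ^+ 2)) *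
     temperature eps (blk1 Q) (blk3 Q / blk1 Q)).
  have := derive_comp2 v deps d1 deta.
  rewrite (is_derive_val h1) (is_derive_val heta) derive_fst derive_snd => <-.
  apply: is_derive_diff.
  apply: (@differentiable_comp _ _ _ _ (fun Q => (blk1 Q, blk3 Q / blk1 Q))
    (fun z : R * R => eps z.1 z.2)) => //.
  exact: differentiable_pair.
have dal : differentiable alpha (blk1 Q).
  by apply: Ck_differentiable (alpha_smooth 1) _.
have hal : is_derive Q v (fun Q => alpha (blk1 Q))
    (blk1 v * derive1 alpha (blk1 Q)).
  have := derive_comp1 v dal d1.
  rewrite (is_derive_val h1) -derive1E => <-; apply: is_derive_diff.
  exact: (differentiable_comp d1 dal).
have r2 : 2 * blk1 Q != 0 by rewrite mulf_neq0.
have hc (c : R) (f : state R d -> R) df : is_derive Q v f df ->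
    is_derive Q v (fun Q => c * f Q) (c * df).
  move=> hf; apply: (is_derive_eq (is_derive_mul (is_derive_cst c Q v) hf)).
  by rewrite mul0r add0r.
have h2r := is_derive_inv (f := fun Q => 2 * blk1 Q) r2 (hc 2 _ _ h1).
have hE := is_derive_add (is_derive_add (is_derive_mul h2r h22)
  (is_derive_mul h1 heps)) (is_derive_mul (hc 2^-1 _ _ hal) h44).
rewrite [LHS](is_derive_val hE) dot_state !blk_mkstate !dotZl.
rewrite /chemical_potential /= [dot (blk2 v) _]dotC [dot (blk4 v) _]dotC.
field; exact: rn0.
Qed.

(** The kinetic and internal energies and the entropy term cancel in U.Q - E,
    leaving rho^2 times the derivative of eps, that is the pressure, and the
    contribution of j. *)
Lemma legendre_energy Q : convex_set (D : set (convex_lmodType (state R d))) ->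
  (forall Q, D Q -> posdef (hess E Q)) -> D Q ->
  legendre D E (grad E Q) = pressure eps (blk1 Q) (blk3 Q / blk1 Q)
  + 2^-1 * (blk1 Q * derive1 alpha (blk1 Q) + alpha (blk1 Q))
    * dot (blk4 Q) (blk4 Q).
Proof.
move=> cD pE DQ; have rn0 : blk1 Q != 0 by rewrite gt_eqF // rho_gt0.
rewrite legendre_grad //; last exact: Ck_energy.
rewrite grad_energy // dot_state !blk_mkstate !dotZl /E /energy.
rewrite /chemical_potential /pressure /=.
by field.
Qed.

End Energy.

(** * The non-conservative symmetric matrices *)

Section NonConservative.
Context {R : realType} {d : nat}.
Implicit Types X : state R d.

Lemma matrix_of_linear n (f : 'cV[R]_n -> 'cV[R]_n) (X : 'cV[R]_n) :
  {morph f : Y Z / Y + Z} -> (forall a Y, f (a *: Y) = a *: f Y) ->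
  (\matrix_(p, q) f (evec q) p 0) *m X = f X.
Proof.
move=> fD fZ; have f0 : f 0 = 0 by have := fZ 0 0; rewrite !scale0r.
rewrite [in RHS](cV_decomp X) (big_morph f fD f0).
apply/colP => p; rewrite mxE summxE; apply: eq_bigr => q _.
by rewrite fZ !mxE mulrC.
Qed.

(** The coefficient of the i-th partial derivative of U in B2_terms, as a linear
    map of that derivative, with j standing for the derivative of Es in l. *)
Definition B2_op (i : 'I_d) (j : 'cV[R]_d) X : state R d :=
  mkstate 0 (blk4 X i 0 *: j - dot j (blk4 X) *: evec i) (blk4 X i 0)
    (blk3 X *: evec i - blk2 X i 0 *: j + dot (blk2 X) j *: evec i).

Definition B2_mx (i : 'I_d) (j : 'cV[R]_d) : 'M[R]_(dimS d) :=
  \matrix_(p, q) B2_op i j (evec q) p 0.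

Lemma mul_B2_mx i j X : B2_mx i j *m X = B2_op i j X.
Proof.
apply: matrix_of_linear => [{}X Y|a {}X]; apply: state_eqP;
  rewrite /B2_op ?(blkD, blkZ) !blk_mkstate ?addr0 ?mulr0 //; try (apply/colP => k);
  rewrite ?(blkD, blkZ, dotDl, dotDr, dotZl, dotZr) !mxE; ring.
Qed.

Lemma B2_op_sym i j X (Y : state R d) : dot (B2_op i j X) Y = dot (B2_op i j Y) X.
Proof.
rewrite !dot_state /B2_op !blk_mkstate.
rewrite -!scaleNr ?(dotDl, dotZl) ![dot (evec i) _]dotC !dot_evec.
rewrite ![dot (blk2 _) j]dotC; ring.
Qed.

Lemma B2_mx_sym i j : symmetric_mx (B2_mx i j).
Proof.
have E p q : B2_mx i j p q = dot (B2_op i j (evec q)) (evec p).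
  by rewrite dot_evec [LHS]mxE.
by apply/matrixP => p q; rewrite [LHS]mxE !E B2_op_sym.
Qed.

Lemma divE (v : 'cV[R]_d -> 'cV[R]_d) x : differentiable v x ->
  div v x = \sum_i ('D_(evec i) v x) i 0.
Proof. by move=> dv; apply: eq_bigr => i _; rewrite derive_mx_coord. Qed.

Lemma mul_jacT (v : 'cV[R]_d -> 'cV[R]_d) (w x : 'cV[R]_d) k :
  differentiable v x ->
  ((jac v x)^T *m w) k 0 = dot ('D_(evec k) v x) w.
Proof.
move=> dv; rewrite mxE; apply: eq_bigr => i _.
by rewrite mxE mxE derive_mx_coord.
Qed.

Lemma sum_delta (F : 'I_d -> R) k :
  \sum_i F i * (evec i : 'cV[R]_d) k 0 = F k.
Proof.
rewrite (bigD1 k) //= evecE eqxx mulr1 big1 ?addr0 // => i ik.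
by rewrite evecE eq_sym (negbTE ik) mulr0.
Qed.

(** The sum over i turns z_i j into div(l) j, the i-th component of l into div(l),
    and the terms along evec i into the components of gradients and transposed
    Jacobians. *)
Lemma sum_B2_mx (Es : state R d -> R) (U : 'cV[R]_d -> state R d) x :
  differentiable U x ->
  \sum_i B2_mx i (blk4 (grad Es (U x))) *m 'D_(evec i) U x = B2_terms Es U x.
Proof.
move=> dU; set j := blk4 _; under eq_bigr do rewrite mul_B2_mx.
have d2 := differentiable_blk2 dU; have d3 := differentiable_blk3 dU.
have d4 := differentiable_blk4 dU.
rewrite /B2_terms -/j; apply: state_eqP; rewrite blk_sum blk_mkstate.
- by rewrite big1 // => i _; rewrite blk_mkstate.
- apply/colP => k; rewrite summxE [RHS]mxE [X in _ = _ + X]mxE mul_jacT //.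
  rewrite [X in _ = X - _]mxE divE // derive_blk4 // mulr_suml.
  under eq_bigr do rewrite blk_mkstate mxE [X in _ + X]mxE mxE [X in _ - X]mxE.
  rewrite big_split /= sumrN sum_delta dotC; congr (_ - _).
  by apply: eq_bigr => i _; rewrite derive_blk4.
- rewrite divE //; apply: eq_bigr => i _.
  by rewrite blk_mkstate derive_blk4.
- apply/colP => k; rewrite summxE.
  under eq_bigr do rewrite blk_mkstate mxE [X in X + _]mxE [X in X + _ + _]mxE
    [X in _ + X + _]mxE [X in _ - X + _]mxE [X in _ + X]mxE.
  rewrite [RHS]mxE mul_jacT // derive_blk2 //.
  rewrite [X in _ = X + _]mxE [X in _ = X + _ + _]mxE [X in _ = _ + X + _]mxE.
  rewrite [X in _ = _ - X + _]mxE derive_blk3 // divE // mulr_suml.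
  rewrite !big_split /= sumrN !sum_delta; congr (_ - _ + _).
  by apply: eq_bigr => i _; rewrite derive_blk2.
Qed.

Lemma is_B2_mx (DU : set (state R d)) (Es : state R d -> R) :
  is_B2 DU Es (fun i U => B2_mx i (blk4 (grad Es U))).
Proof.
by split=> [i U _|U x dU _]; [exact: B2_mx_sym|exact: sum_B2_mx].
Qed.

(** Evaluating the defining identity on the affine field U + x_i v recovers
    the product of the i-th matrix with an arbitrary vector v. *)
Lemma is_B2_unique (DU : set (state R d)) (Es : state R d -> R) B2 B2' :
  is_B2 DU Es B2 -> is_B2 DU Es B2' ->
  forall i U, DU U -> B2' i U = B2 i U.
Proof.
move=> [_ H] [_ H'] i U UU.
have mulE (v : state R d) : B2' i U *m v = B2 i U *m v.
  pose F (y : 'cV[R]_d) := U + y i 0 *: v.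
  have dFl : differentiable (fun y : 'cV[R]_d => y i 0 *: v) 0.
    by apply: differentiableZl; exact: differentiable_coord.
  have dF : differentiable F 0 by exact: differentiableD.
  have F0 : F 0 = U by rewrite /F mxE scale0r addr0.
  have DF k : 'D_(evec k) F 0 = (i == k)%:R *: v.
    rewrite deriveD; [|exact: derivable_cst|exact: diff_derivable].
    rewrite derive_cst add0r deriveE // diffZl; last exact: differentiable_coord.
    by rewrite -deriveE ?(is_derive_val (is_derive_coord _ _ _ _)) ?evecE //;
       exact: differentiable_coord.
  have sumE (B : 'I_d -> state R d -> 'M[R]_(dimS d)) :
      \sum_k B k (F 0) *m 'D_(evec k) F 0 = B i U *m v.
    rewrite F0 (bigD1 i) //= DF eqxx scale1r big1 ?addr0 // => k ki.
    by rewrite DF eq_sym (negbTE ki) scale0r mulmx0.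
  have UF : DU (F 0) by rewrite F0.
  by rewrite -!sumE H // H'.
apply/matrixP => p q; have := mulE (delta_mx q 0).
by rewrite -!colE => /colP/(_ p); rewrite !mxE.
Qed.

End NonConservative.

(** * Flux identities for curl-free fields *)

Section Fluxes.
Context {R : realType} {d : nat}.
Implicit Types (u j l : 'cV[R]_d -> 'cV[R]_d) (x : 'cV[R]_d).

Lemma div_near u l x : (\near x, u x = l x) -> div u x = div l x.
Proof.
move=> ul; apply: eq_bigr => i _; apply: near_eq_derive.
by apply: filterS ul => y ->.
Qed.

Lemma jac_near u l x : (\near x, u x = l x) -> jac u x = jac l x.
Proof.
move=> ul; apply/matrixP => i k; rewrite !mxE; apply: near_eq_derive.
by apply: filterS ul => y ->.
Qed.

Lemma grad_near (f g : 'cV[R]_d -> R) x :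
  (\near x, f x = g x) -> grad f x = grad g x.
Proof. by move=> fg; apply/colP => i; rewrite !mxE; exact: near_eq_derive. Qed.

Lemma divT_near (A B : 'cV[R]_d -> 'M[R]_d) x :
  (\near x, A x = B x) -> divT A x = divT B x.
Proof.
move=> AB; apply/colP => k; rewrite !mxE; apply: div_near.
by apply: filterS AB => y ->.
Qed.

(** Curl-freeness exchanges the direction of differentiation and the component. *)
Lemma is_derive_curl_free j x i k : differentiable j x ->
  symmetric_mx (jac j x) ->
  is_derive x (evec i) (fun y => j y k 0) (('D_(evec k) j x) i 0).
Proof.
move=> dj /matrixP/(_ i k); rewrite !mxE => jE.
rewrite (derive_mx_coord _ _ _ dj) -jE.
exact/is_derive_diff/differentiable_mx_coord.
Qed.

(** With e the Legendre transform of the energy, e - l.j is the total pressure;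
    the terms l_i (d_i j_k - d_k j_i) vanish because j is curl-free. *)
Lemma momentum_flux (rho e : 'cV[R]_d -> R) u j l x :
  differentiable rho x -> differentiable e x -> differentiable u x ->
  differentiable j x -> differentiable l x -> symmetric_mx (jac j x) ->
  divT (fun y => rho y *: (u y *m (u y)^T) + (e y - dot (l y) (j y))%:M
                 + l y *m (j y)^T) x =
  \sum_i 'D_(evec i) (fun y => u y i 0 *: (rho y *: u y) + e y *: evec i) x
  + (div l x *: j x - (jac l x)^T *m j x).
Proof.
move=> dr de du dj dl js.
have dc (v : 'cV[R]_d -> 'cV[R]_d) i : differentiable v x ->
    differentiable (fun y => v y i 0) x by exact: differentiable_mx_coord.
have dG i : differentiable (fun y => u y i 0 *: (rho y *: u y) + e y *: evec i) x.
  apply: differentiable_mx => k z; rewrite ord1.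
  rewrite (_ : (fun y => _) =
    fun y => u y i 0 * (rho y * u y k 0) + e y * (evec i : 'cV[R]_d) k 0).
    apply: differentiableD; last exact: differentiable_mul.
    by apply: differentiable_mul; [exact: dc|]; apply: differentiable_mul => //; exact: dc.
  by apply/funext => y; rewrite !mxE.
apply/colP => k; rewrite mxE [RHS]mxE summxE.
rewrite [X in _ = _ + X]mxE [X in _ = _ + (X + _)]mxE [X in _ = _ + (_ + X)]mxE.
rewrite (mul_jacT _ _ dl) (divE dl).
pose cE i := - (dot ('D_(evec i) l x) (j x) + dot (l x) ('D_(evec i) j x)).
have termE i : 'D_(evec i) (fun y => ((rho y *: (u y *m (u y)^T)
      + (e y - dot (l y) (j y))%:M + l y *m (j y)^T) *m evec k) i 0) x =
    ('D_(evec i) (fun y => u y i 0 *: (rho y *: u y) + e y *: evec i) x) k 0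
    + cE i * (evec i : 'cV[R]_d) k 0
    + (('D_(evec i) l x) i 0 * j x k 0 + l x i 0 * ('D_(evec k) j x) i 0).
  rewrite (derive_mx_coord _ _ _ (dG i)).
  have -> : (fun y => ((rho y *: (u y *m (u y)^T)
      + (e y - dot (l y) (j y))%:M + l y *m (j y)^T) *m evec k) i 0) =
    (fun y => (u y i 0 *: (rho y *: u y) + e y *: evec i) k 0
      - dot (l y) (j y) * (evec i : 'cV[R]_d) k 0 + l y i 0 * j y k 0).
    apply/funext => y; rewrite -colE !mxE !big_ord1 !mxE eqxx andbT [k == i]eq_sym.
    rewrite -[_ *+ (i == k)]mulr_natr; ring.
  have h1 : is_derive x (evec i)
      (fun y => (u y i 0 *: (rho y *: u y) + e y *: evec i) k 0)
      ('D_(evec i) (fun y => (u y i 0 *: (rho y *: u y) + e y *: evec i) k 0) x).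
    by apply/is_derive_diff/differentiable_mx_coord/dG.
  have h2 := is_derive_mul (is_derive_dot (evec i) dl dj)
    (is_derive_cst ((evec i : 'cV[R]_d) k 0) x (evec i)).
  have h3 := is_derive_mul (is_derive_entry (evec i) i dl)
    (is_derive_curl_free i k dj js).
  rewrite (is_derive_val (is_derive_add (is_derive_sub h1 h2) h3)).
  by rewrite mulr0 addr0 /cE /cst mulNr.
rewrite /div (eq_bigr _ (fun i _ => termE i)) !big_split /= sum_delta /cE.
by rewrite -mulr_suml -/(dot (l x) ('D_(evec k) j x)); ring.
Qed.

(** Curl-freeness cancels (dj/dx - (dj/dx)^T) u, and identifies the advection
    terms u_i d_i j_k with the terms u_i d_k j_i of the gradient of j.u. *)
Lemma curl_free_flux (theta : 'cV[R]_d -> R) u j x :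
  differentiable theta x -> differentiable u x -> differentiable j x ->
  symmetric_mx (jac j x) ->
  grad (fun y => dot (j y) (u y) + theta y) x
  + (jac j x - (jac j x)^T) *m u x =
  \sum_i 'D_(evec i) (fun y => u y i 0 *: j y) x
  + (grad theta x - div u x *: j x + (jac u x)^T *m j x).
Proof.
move=> dt du dj js; rewrite [(jac j x)^T]js subrr mul0mx addr0.
have dc (v : 'cV[R]_d -> 'cV[R]_d) i : differentiable v x ->
    differentiable (fun y => v y i 0) x by exact: differentiable_mx_coord.
apply/colP => k; rewrite mxE [RHS]mxE summxE.
rewrite [X in _ = _ + X]mxE mul_jacT // [X in _ = _ + (X + _)]mxE.
rewrite [X in _ = _ + (X + _ + _)]mxE [X in _ = _ + (_ + X + _)]mxE.
rewrite [X in _ = _ + (_ - X + _)]mxE divE //.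
rewrite (is_derive_val (is_derive_add (is_derive_dot (evec k) dj du)
  (is_derive_diff (evec k) dt))).
have termE i : ('D_(evec i) (fun y => u y i 0 *: j y) x) k 0 =
    ('D_(evec i) u x) i 0 * j x k 0 + u x i 0 * ('D_(evec k) j x) i 0.
  have dG : differentiable (fun y => u y i 0 *: j y) x.
    apply: differentiable_mx => p z; rewrite ord1.
    rewrite (_ : (fun y => _) = fun y => u y i 0 * j y p 0).
      by apply: differentiable_mul; exact: dc.
    by apply/funext => y; rewrite mxE.
  rewrite (derive_mx_coord _ _ _ dG).
  rewrite (_ : (fun y => _) = fun y => u y i 0 * j y k 0); last first.
    by apply/funext => y; rewrite mxE.
  exact: is_derive_val (is_derive_mul (is_derive_entry (evec i) i du)
    (is_derive_curl_free i k dj js)).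
rewrite (eq_bigr _ (fun i _ => termE i)) big_split /= -mulr_suml.
rewrite -/(dot (u x) ('D_(evec k) j x)) [dot (u x) _]dotC.
by rewrite [dot (j x) _]dotC; ring.
Qed.

End Fluxes.

(** * The system in the conjugate variables *)

Section Slices.
Context {R : realType} {V W : normedModType R}.

Lemma near_slice (Omega : set (R * V)) t x : open Omega -> Omega (t, x) ->
  (\forall s \near t, Omega (s, x)) /\ (\forall y \near x, Omega (t, y)).
Proof.
move=> oO Otx; have nO : nbhs (t, x) Omega by exact: open_nbhs_nbhs.
have cs : {for t, continuous (fun s : R => (s, x))}.
  by apply: differentiable_continuous; exact: differentiable_pair.
have cy : {for x, continuous (fun y : V => (t, y))}.
  by apply: differentiable_continuous; exact: differentiable_pair.
by split; [exact: cs nO|exact: cy nO].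
Qed.

Lemma differentiable_slice (f : R -> V -> W) t x :
  differentiable (fun z : R * V => f z.1 z.2) (t, x) ->
  differentiable (fun s => f s x) t /\ differentiable (f t) x.
Proof.
move=> df.
have ds : differentiable (fun s : R => (s, x)) t by exact: differentiable_pair.
have dy : differentiable (fun y : V => (t, y)) x by exact: differentiable_pair.
split; first exact: (differentiable_comp ds df).
exact: (differentiable_comp dy df).
Qed.

End Slices.

Section System.
Context {R : realType} {d : nat} (eps : R -> R -> R) (alpha : R -> R).
Variables (tau : state R d -> R) (D : set (state R d)).
Hypothesis oD : open D.
Hypothesis cD : convex_set (D : set (convex_lmodType (state R d))).
Hypothesis rho_gt0 : forall Q, D Q -> 0 < blk1 Q.
Hypothesis eps_smooth : smooth (thermo D) (fun z : R * R => eps z.1 z.2).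
Hypothesis alpha_smooth : smooth [set r : R | 0 < r] alpha.

Let E : state R d -> R := energy eps alpha.
Hypothesis pE : forall Q, D Q -> posdef (hess E Q).

Let DU := grad E @` D.
Let Es := legendre D E.

Let CE : Ck 2 D E.
Proof. exact (Ck_energy oD rho_gt0 eps_smooth alpha_smooth 2). Qed.
Let oDU : open DU. Proof. exact (open_grad_image oD cD CE pE). Qed.
Let CEs : Ck 2 DU Es. Proof. exact (Ck2_legendre oD cD CE pE). Qed.

Lemma Ck_Es_velocity i : Ck 2 DU (fun W => Es W * blk2 W i 0).
Proof.
have Cb : Ck 2 DU (fun W => blk2 W i 0).
  by apply: (Ck_ext oDU _ (Ck_coord 2 DU (pos2 i) 0)) => W _; rewrite blk2E.
exact (Ck_mul oDU CEs Cb).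
Qed.

(** The gradient of Es is Q, and u_i is a coordinate of U. *)
Lemma grad_Es_velocity i Q : D Q ->
  grad (fun W => Es W * blk2 W i 0) (grad E Q) =
  blk2 (grad E Q) i 0 *: Q + Es (grad E Q) *: mkstate 0 (evec i) 0 0.
Proof.
move=> DQ; have UU : DU (grad E Q) by exists Q.
apply: dot_inj => v; rewrite -derive_grad; last first.
  by apply: Ck_differentiable UU; exact: (CkW (Ck_Es_velocity i)).
have h1 : is_derive (grad E Q) v Es (dot Q v).
  have := is_derive_legendre oD cD CE pE v UU.
  by rewrite (state_ofK cD CE pE DQ).
have h2 := is_derive_entry v i (differentiable_blk2 (differentiable_id (grad E Q))).
rewrite (is_derive_val (is_derive_mul h1 h2)).
rewrite derive_blk2 // derive_id dotDl !dotZl [dot (mkstate _ _ _ _) _]dot_state.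
rewrite !blk_mkstate !mul0r addr0 add0r [dot 0 _]dot_mx trmx0 mul0mx.
by rewrite [X in _ = _ + _ * (_ + X)]mxE addr0 [dot (evec i) _]dotC dot_evec mulrC.
Qed.

Section Point.
Variables (Omega : set (R * 'cV[R]_d)).
Variables (rho : R -> 'cV[R]_d -> R) (u : R -> 'cV[R]_d -> 'cV[R]_d).
Variables (eta : R -> 'cV[R]_d -> R) (j : R -> 'cV[R]_d -> 'cV[R]_d).
Hypothesis oO : open Omega.
Hypothesis rho_diff : forall t x, Omega (t, x) ->
  differentiable (fun z : R * 'cV[R]_d => rho z.1 z.2) (t, x).
Hypothesis u_diff : forall t x, Omega (t, x) ->
  differentiable (fun z : R * 'cV[R]_d => u z.1 z.2) (t, x).
Hypothesis eta_diff : forall t x, Omega (t, x) ->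
  differentiable (fun z : R * 'cV[R]_d => eta z.1 z.2) (t, x).
Hypothesis j_diff : forall t x, Omega (t, x) ->
  differentiable (fun z : R * 'cV[R]_d => j z.1 z.2) (t, x).
Hypothesis QD : forall t x, Omega (t, x) -> D (conserved rho u eta j t x).
Hypothesis j_curl_free : forall t x, Omega (t, x) -> symmetric_mx (jac (j t) x).

Let Q t x := conserved rho u eta j t x.
Let U t x := grad E (Q t x).
Let theta t x := temperature eps (rho t x) (eta t x).
Let l t x := alpha (rho t x) *: j t x.

Lemma rho_neq0 t x : Omega (t, x) -> rho t x != 0.
Proof.
by move=> /QD/rho_gt0; rewrite /conserved blk_mkstate => r0; rewrite gt_eqF.
Qed.

Lemma conjugate_blocks t x : Omega (t, x) ->
  [/\ blk2 (U t x) = u t x, blk3 (U t x) = theta t x & blk4 (U t x) = l t x].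
Proof.
move=> Otx; have r0 := rho_neq0 Otx.
rewrite /U /E (grad_energy oD rho_gt0 eps_smooth alpha_smooth (QD Otx)).
rewrite /conserved !blk_mkstate /theta scalerA mulVf // scale1r.
by rewrite [rho t x * _]mulrC mulfK.
Qed.

Lemma Es_conjugate t x : Omega (t, x) ->
  Es (U t x) = pressure eps (rho t x) (eta t x) + 2^-1 *
    (rho t x * derive1 alpha (rho t x) + alpha (rho t x)) * dot (j t x) (j t x).
Proof.
move=> Otx; rewrite /Es /U /E.
rewrite (legendre_energy oD rho_gt0 eps_smooth alpha_smooth cD pE (QD Otx)).
by rewrite /conserved !blk_mkstate [rho t x * eta t x]mulrC mulfK // rho_neq0.
Qed.

Lemma differentiable_conserved t x : Omega (t, x) ->
  differentiable (fun z : R * 'cV[R]_d => Q z.1 z.2) (t, x).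
Proof.
move=> Otx; have dr := rho_diff Otx; have du := u_diff Otx.
apply: differentiable_mkstate => //.
- apply: differentiable_mx => k i; rewrite ord1.
  rewrite (_ : (fun y => _) = fun y => rho y.1 y.2 * u y.1 y.2 k 0).
    apply: differentiable_mul => //.
    exact: (differentiable_mx_coord (F := fun z => u z.1 z.2)).
  by apply/funext => y; rewrite mxE.
- exact: differentiable_mul (eta_diff Otx).
- exact: j_diff.
Qed.

(** The chain rule turns the matrices of second derivatives into derivatives
    of grad Es = Q and of grad (Es u_i) = u_i Q + Es d u_i / d U. *)
Lemma quasilinear_conservative t x B2 S : Omega (t, x) -> is_B2 DU Es B2 ->
  quasilinear_system (hess Es)
    (fun i W => hess (fun W => Es W * blk2 W i 0) W + B2 i W) S U t x <->
  'D_1 (fun s => Q s x) t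
  + \sum_i 'D_(evec i) (fun y => u t y i 0 *: Q t y
      + Es (U t y) *: mkstate 0 (evec i) 0 0) x
  + B2_terms Es (U t) x = S (U t x).
Proof.
move=> Otx [_ HB2]; have [nt nx] := near_slice oO Otx.
have [dQt dQx] := differentiable_slice (differentiable_conserved Otx).
have dgE : differentiable (grad E) (Q t x).
  exact: differentiable_gradient CE (QD Otx).
have dUt : differentiable (fun s => U s x) t by exact: (differentiable_comp dQt dgE).
have dUx : differentiable (U t) x by exact: (differentiable_comp dQx dgE).
have UU : DU (U t x) by exists (Q t x) => //; exact: QD.
have timeE : hess Es (U t x) *m derive1 (fun s => U s x) t = 'D_1 (fun s => Q s x) t.
  have dgEs : differentiable (grad Es) (U t x).
    exact: differentiable_gradient CEs UU.
  rewrite derive1E -(@derive_jac_chain _ R _ _ _ _ _ 1 dUt dgEs).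
  apply: near_eq_derive; apply: filterS nt => s Os.
  have DQ := QD Os.
  rewrite (grad_legendre oD cD CE pE); last by exists (Q s x).
  exact (state_ofK cD CE pE DQ).
have spaceE i : hess (fun W => Es W * blk2 W i 0) (U t x) *m 'D_(evec i) (U t) x =
    'D_(evec i) (fun y => u t y i 0 *: Q t y
      + Es (U t y) *: mkstate 0 (evec i) 0 0) x.
  have dgi := differentiable_gradient (Ck_Es_velocity i) UU.
  rewrite -(derive_jac_chain (evec i) dUx dgi).
  apply: near_eq_derive; apply: filterS nx => y Oy.
  have [b2 _ _] := conjugate_blocks Oy.
  by rewrite (grad_Es_velocity i (QD Oy)) -b2.
rewrite /quasilinear_system timeE.
under eq_bigr do rewrite mulmxDl spaceE.
by rewrite big_split /= HB2 // addrA.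
Qed.

(** Both systems are compared block by block at one point. In the momentum block
    Es - l.j is the total pressure p + (rho alpha' - alpha) |j|^2 / 2. *)
Lemma heat_flow_iff t x B2 : Omega (t, x) -> is_B2 DU Es B2 ->
  heat_flow_system eps alpha tau rho u eta j t x <->
  quasilinear_system (hess Es)
    (fun i W => hess (fun W => Es W * blk2 W i 0) W + B2 i W)
    (fun W => source eps alpha tau (state_of D E W)) U t x.
Proof.
move=> Otx HB2; rewrite quasilinear_conservative //.
have [nt nx] := near_slice oO Otx; have js := j_curl_free Otx.
have [dQt dQx] := differentiable_slice (differentiable_conserved Otx).
have [_ dr] := differentiable_slice (rho_diff Otx).
have [_ du] := differentiable_slice (u_diff Otx).
have [_ dj] := differentiable_slice (j_diff Otx).
have DQ := QD Otx; have r0 := rho_neq0 Otx.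
have UU : DU (U t x) by exists (Q t x).
have dgE : differentiable (grad E) (Q t x).
  exact: differentiable_gradient CE DQ.
have dUx : differentiable (U t) x by exact: (differentiable_comp dQx dgE).
have dP : differentiable (fun y => Es (U t y)) x.
  by apply: (differentiable_comp dUx); exact: CEs.1.
have nth : \near x, blk3 (U t x) = theta t x.
  by apply: filterS nx => y /conjugate_blocks[].
have nl : \near x, blk4 (U t x) = l t x.
  by apply: filterS nx => y /conjugate_blocks[].
have nu : \near x, blk2 (U t x) = u t x.
  by apply: filterS nx => y /conjugate_blocks[].
have dth : differentiable (theta t) x.
  exact: differentiable_near nth (differentiable_blk3 dUx).
have dl : differentiable (l t) x.
  exact: differentiable_near nl (differentiable_blk4 dUx).
have dui i : differentiable (fun y => u t y i 0) x.
  exact: differentiable_mx_coord.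
pose G i y := u t y i 0 *: Q t y + Es (U t y) *: mkstate 0 (evec i) 0 0.
have dG i : differentiable (G i) x.
  apply: differentiable_mx => k z; rewrite ord1.
  rewrite (_ : (fun y => _) = fun y => u t y i 0 * Q t y k 0
    + Es (U t y) * (mkstate 0 (evec i) 0 0 : state R d) k 0).
    apply: differentiableD; last exact: differentiable_mul.
    by apply: differentiable_mul => //; exact: differentiable_mx_coord.
  by apply/funext => y; rewrite [LHS]mxE [X in X + _]mxE [X in _ + X]mxE.
have gEs : blk4 (grad Es (U t x)) = j t x.
  rewrite /Es (grad_legendre oD cD CE pE UU) /U (state_ofK cD CE pE DQ).
  by rewrite /Q /conserved blk_mkstate.
have B2E : B2_terms Es (U t) x = mkstate 0
    (div (l t) x *: j t x - (jac (l t) x)^T *m j t x) (div (l t) x)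
    (grad (theta t) x - div (u t) x *: j t x + (jac (u t) x)^T *m j t x).
  rewrite /B2_terms gEs (div_near nl) (jac_near nl) (div_near nu) (jac_near nu).
  by rewrite (grad_near nth).
have SQ : state_of D E (U t x) = Q t x by exact (state_ofK cD CE pE DQ).
rewrite SQ B2E; set L := (X in _ <-> X = _).
have LE : L = 'D_1 (fun s => Q s x) t + \sum_i 'D_(evec i) (G i) x + mkstate 0
    (div (l t) x *: j t x - (jac (l t) x)^T *m j t x) (div (l t) x)
    (grad (theta t) x - div (u t) x *: j t x + (jac (u t) x)^T *m j t x) by [].
clearbody L.
have L1 : blk1 L = derive1 (fun s => rho s x) t + div (fun y => rho t y *: u t y) x.
  rewrite LE !blkD blk_sum blk_mkstate addr0 -derive_blk1 // derive1E.
  have -> : (fun s => blk1 (Q s x)) = fun s => rho s x.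
    by apply/funext => s; rewrite blk_mkstate.
  congr (_ + _); apply: eq_bigr => i _; rewrite -derive_blk1 //.
  have -> : (fun y => blk1 (G i y)) = fun y => (rho t y *: u t y) i 0.
    apply/funext => y; rewrite blkD !blkZ !blk_mkstate mulr0 addr0.
    by rewrite [RHS]mxE mulrC.
  by [].
have L2 : blk2 L = derive1 (fun s => rho s x *: u s x) t
    + divT (fun y => rho t y *: (u t y *m (u t y)^T)
      + (pressure eps (rho t y) (eta t y)
         + 2^-1 * (rho t y * derive1 alpha (rho t y) - alpha (rho t y))
           * dot (j t y) (j t y))%:M
      + alpha (rho t y) *: (j t y *m (j t y)^T)) x.
  rewrite LE !blkD blk_sum blk_mkstate -derive_blk2 // derive1E -addrA.
  have -> : (fun s => blk2 (Q s x)) = fun s => rho s x *: u s x.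
    by apply/funext => s; rewrite blk_mkstate.
  congr (_ + _).
  have nA : \forall y \near x, rho t y *: (u t y *m (u t y)^T)
      + (Es (U t y) - dot (l t y) (j t y))%:M + l t y *m (j t y)^T =
      rho t y *: (u t y *m (u t y)^T)
      + (pressure eps (rho t y) (eta t y)
         + 2^-1 * (rho t y * derive1 alpha (rho t y) - alpha (rho t y))
           * dot (j t y) (j t y))%:M
      + alpha (rho t y) *: (j t y *m (j t y)^T).
    apply: filterS nx => y Oy; rewrite -scalemxAl; congr (_ + _%:M + _).
    by rewrite Es_conjugate // dotZl; field.
  rewrite -(divT_near nA) (momentum_flux dr dP du dj dl js); congr (_ + _).
  apply: eq_bigr => i _; rewrite -derive_blk2 //.
  have -> : (fun y => blk2 (G i y)) =
      fun y => u t y i 0 *: (rho t y *: u t y) + Es (U t y) *: evec i.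
    by apply/funext => y; rewrite blkD !blkZ !blk_mkstate.
  by [].
have L3 : blk3 L = derive1 (fun s => rho s x * eta s x) t
    + div (fun y => (rho t y * eta t y) *: u t y + alpha (rho t y) *: j t y) x.
  rewrite LE !blkD blk_sum blk_mkstate -derive_blk3 // derive1E -addrA.
  have -> : (fun s => blk3 (Q s x)) = fun s => rho s x * eta s x.
    by apply/funext => s; rewrite blk_mkstate.
  congr (_ + _); rewrite [X in _ + X](divE dl) -big_split /=.
  apply: eq_bigr => i _; rewrite -derive_blk3 //.
  have dQ3 : differentiable (fun y => blk3 (G i y)) x.
    exact: differentiable_blk3.
  have -> : (fun y => ((rho t y * eta t y) *: u t y + alpha (rho t y) *: j t y) i 0)
      = fun y => blk3 (G i y) + l t y i 0.
    apply/funext => y; rewrite blkD !blkZ !blk_mkstate mulr0 addr0.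
    by rewrite [LHS]mxE [X in X + _]mxE mulrC.
  apply/esym/is_derive_val/is_derive_add; first exact: is_derive_diff.
  exact: is_derive_entry.
have L4 : blk4 L = derive1 (fun s => j s x) t
    + grad (fun y => dot (j t y) (u t y) + theta t y) x
    + (jac (j t) x - (jac (j t) x)^T) *m u t x.
  rewrite LE !blkD blk_sum blk_mkstate -derive_blk4 // derive1E -!addrA.
  have -> : (fun s => blk4 (Q s x)) = fun s => j s x.
    by apply/funext => s; rewrite blk_mkstate.
  congr (_ + _); rewrite (curl_free_flux dth du dj js) -!addrA; congr (_ + _).
  apply: eq_bigr => i _; rewrite -derive_blk4 //.
  have -> : (fun y => blk4 (G i y)) = fun y => u t y i 0 *: j t y.
    by apply/funext => y; rewrite blkD !blkZ !blk_mkstate scaler0 addr0.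
  by [].
have S1 : blk1 (source eps alpha tau (Q t x)) = 0 by rewrite blk_mkstate.
have S2 : blk2 (source eps alpha tau (Q t x)) = 0 by rewrite blk_mkstate.
have S3 : blk3 (source eps alpha tau (Q t x)) =
    alpha (rho t x) / (tau (Q t x) * theta t x) * dot (j t x) (j t x).
  rewrite /source !blk_mkstate /Q /conserved.
  by rewrite [rho t x * eta t x]mulrC mulfK.
have S4 : blk4 (source eps alpha tau (Q t x)) = - ((tau (Q t x))^-1 *: j t x).
  by rewrite /source !blk_mkstate.
rewrite /heat_flow_system -L1 -L2 -L3 -L4; split=> [[h1 h2 h4 h3]|->].
  by apply: state_eqP; rewrite ?S1 ?S2 ?S3 ?S4.
by rewrite S1 S2 S3 S4.
Qed.

End Point.
End System.

Theorem mainTheorem3 (R : realType) (d : nat)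
  (eps : R -> R -> R) (alpha : R -> R) (tau : state R d -> R)
  (D : set (state R d))
  (D_open : open D)
  (D_convex : convex_set (D : set (convex_lmodType (state R d))))
  (rho_gt0 : forall Q, D Q -> 0 < blk1 Q)
  (eps_smooth : smooth (thermo D) (fun z : R * R => eps z.1 z.2))
  (theta_gt0 : forall z, thermo D z -> 0 < temperature eps z.1 z.2)
  (alpha_smooth : smooth [set r : R | 0 < r] alpha)
  (alpha_gt0 : forall r : R, 0 < r -> 0 < alpha r)
  (tau_gt0 : forall Q, D Q -> 0 < tau Q)
  (E_convex : convex_function (D : set (convex_lmodType (state R d)))
                              (energy eps alpha))
  (E_posdef : forall Q, D Q -> posdef (hess (energy eps alpha) Q)) :
  let E : state R d -> R := energy eps alpha in
  let DU : set (state R d) := grad E @` D in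
  let Es : state R d -> R := legendre D E in
  let A : state R d -> 'M[R]_(dimS d) := hess Es in
  let S : state R d -> state R d :=
    fun U => source eps alpha tau (state_of D E U) in
  [/\ {in D &, injective (grad E)},
      open DU,
      Ck 2 DU Es,
      (forall Q, D Q ->
         [/\ blk2 (grad E Q) = (blk1 Q)^-1 *: blk2 Q,
             blk3 (grad E Q) = temperature eps (blk1 Q) (blk3 Q / blk1 Q)
           & blk4 (grad E Q) = alpha (blk1 Q) *: blk4 Q])
    & exists B2 : 'I_d -> state R d -> 'M[R]_(dimS d),
        let B : 'I_d -> state R d -> 'M[R]_(dimS d) :=
          fun i U => hess (fun W => Es W * blk2 W i 0) U + B2 i U in
        [/\ is_B2 DU Es B2,
            (forall B2', is_B2 DU Es B2' ->
               forall i U, DU U -> B2' i U = B2 i U),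
            friedrichs DU A B
          & forall (Omega : set (R * 'cV[R]_d))
              (rho : R -> 'cV[R]_d -> R) (u : R -> 'cV[R]_d -> 'cV[R]_d)
              (eta : R -> 'cV[R]_d -> R) (j : R -> 'cV[R]_d -> 'cV[R]_d),
              open Omega ->
              smooth Omega (fun z : R * 'cV[R]_d => rho z.1 z.2) ->
              smooth Omega (fun z : R * 'cV[R]_d => u z.1 z.2) ->
              smooth Omega (fun z : R * 'cV[R]_d => eta z.1 z.2) ->
              smooth Omega (fun z : R * 'cV[R]_d => j z.1 z.2) ->
              (forall t x, Omega (t, x) -> D (conserved rho u eta j t x)) ->
              (forall t x, Omega (t, x) -> symmetric_mx (jac (j t) x)) ->
              (forall t x, Omega (t, x) ->
                 heat_flow_system eps alpha tau rho u eta j t x) <->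
              (forall t x, Omega (t, x) ->
                 quasilinear_system A B S
                   (fun s y => grad E (conserved rho u eta j s y)) t x)]].
Proof.
move=> E DU Es A S.
have CE : Ck 2 D E by exact (Ck_energy D_open rho_gt0 eps_smooth alpha_smooth 2).
have gE Q (DQ : D Q) := grad_energy D_open rho_gt0 eps_smooth alpha_smooth DQ.
have oDU : open DU by exact (open_grad_image D_open D_convex CE E_posdef).
split.
- exact (grad_inj D_convex CE E_posdef).
- exact oDU.
- exact (Ck2_legendre D_open D_convex CE E_posdef).
- by move=> Q /gE gQ; rewrite /E gQ !blk_mkstate.
exists (fun i U => B2_mx i (blk4 (grad Es U))) => B.
have HB2 := is_B2_mx DU Es; split.
- exact HB2.
- by move=> B2'; exact: is_B2_unique.
- move=> U UU.
  have [sA pA] := legendre_friedrichs D_open D_convex CE E_posdef UU.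
  split=> // i; rewrite /symmetric_mx /B [LHS]linearD /=.
  have Ci := Ck_Es_velocity D_open D_convex rho_gt0 eps_smooth alpha_smooth
    E_posdef i.
  by rewrite (hess_sym oDU Ci UU) B2_mx_sym.
- move=> Omega rho u eta j oO Crho Cu Ceta Cj QD cf.
  have dif (W : normedModType R) (f : R * 'cV[R]_d -> W) t x :
      smooth Omega f -> Omega (t, x) -> differentiable f (t, x).
    by move=> Cf Otx; exact: Ck_differentiable (Cf 1) Otx.
  have HI t x (Otx : Omega (t, x)) := heat_flow_iff tau D_open D_convex rho_gt0
    eps_smooth alpha_smooth E_posdef oO
    (fun t x => dif _ _ t x Crho) (fun t x => dif _ _ t x Cu)
    (fun t x => dif _ _ t x Ceta) (fun t x => dif _ _ t x Cj)
    QD cf Otx HB2.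
  by split=> H t x Otx; have [h1 h2] := HI t x Otx; [apply: h1|apply: h2];
    exact: H.
Qed.
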